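(* Let $R$ be a $\phi$-ring. Then the following statements are equivalent: (1) $R$ is a $\phi$-Pr\''{u}fer ring and a strong $\phi$-ring; (2) every divisible $R$-module is nonnil-FP-injective; (3) every $h$-divisible $R$-module is nonnil-FP-injective; (4) every finitely generated nonnil ideal of $R$ is projective; (5) every nonnil ideal of $R$ is flat; (5') every finitely generated nonnil ideal of $R$ is flat; (6) every ideal of $R$ is $\phi$-flat; (6') every finitely generated ideal of $R$ is $\phi$-flat; (7) every submodule of a $\phi$-flat $R$-module is $\phi$-flat; (8) every $R$-module has a $\phi$-flat preenvelope that is an epimorphism; (9) every $R$-module has a $\phi$-flat envelope that is an epimorphism.
   Context: All rings are commutative with identity and all modules are unitary. $\mathrm{Nil}(R)$ is the set of nilpotent elements and $\mathrm{Z}(R)$ the set of zero-divisors (including $0$) of $R$; an element is regular if it is not a zero-divisor. $R$ is a $\phi$-ring if $\mathrm{Nil}(R)$ is a divided prime ideal, i.e. $\mathrm{Nil}(R)$ is a prime ideal and $\mathrm{Nil}(R)\subsetneq (x)$ for every $x\in R\setminus \mathrm{Nil}(R)$. A strong $\phi$-ring is a $\phi$-ring with $\mathrm{Z}(R)=\mathrm{Nil}(R)$. $\mathrm{T}(R)$ is the localization of $R$ at the set of all regular elements. For a $\phi$-ring $R$, $\phi:\mathrm{T}(R)\to R_{\mathrm{Nil}(R)}$ is the ring homomorphism $\phi(a/b)=a/b$, and $\phi(R)$ denotes the image of $R$ (i.e. the image of $R\to R_{\mathrm{Nil}(R)}$, $r\mapsto r/1$); for an ideal $I$ of $R$, $\phi(I)$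 is its image, an ideal of $\phi(R)$. An ideal is regular if it contains a regular element. A regular ideal $J$ of a ring $A$ is invertible if $JJ^{-1}=A$, where $J^{-1}=\{x\in \mathrm{T}(A): Jx\subseteq A\}$. An ideal of $R$ is nonnil if it contains a non-nilpotent element. A nonnil ideal $I$ of a $\phi$-ring $R$ is $\phi$-invertible if $\phi(I)$ is an invertible ideal of $\phi(R)$. A $\phi$-ring $R$ is $\phi$-Pr\''{u}fer if every finitely generated nonnil ideal of $R$ is $\phi$-invertible. An $R$-module $E$ is divisible if $sE=E$ for every regular element $s\in R$; it is $h$-divisible if it is a quotient of an injective module. An $R$-module $T$ is $\phi$-torsion if for every $x\in T$ there is a nonnil ideal $I$ of $R$ with $Ix=0$. An $R$-module $M$ is nonnil-FP-injective if $\operatorname{Ext}^1_R(T,M)=0$ for every finitely presented $\phi$-torsion $R$-module $T$; it is $\phi$-flat if $\operatorname{Tor}_1^R(T,M)=0$ for every $\phi$-torsion $R$-module $T$. A $\phi$-flat preenvelope of an $R$-module $M$ is a homomorphism $f:M\to F$ with $F$ $\phi$-flat such that every homomorphism $f':M\to F'$ with $F'$ $\phi$-flat factors as $f'=g\circ f$ for some $g:F\to F'$. It is a $\phi$-flat envelope if moreover every endomorphism $g:F\to F$ with $g\circ f=f$ is an automorphism. *)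

(* Defs.v *)
From HB Require Import structures.
From mathcomp Require Import all_boot all_order all_algebra.
From mathcomp Require Import generic_quotient ring_quotient.
From mathcomp Require Import finmap monalg.
From mathcomp Require Import boolp functions.
From mathcomp Require Import ring.

Set Implicit Arguments.
Unset Strict Implicit.
Unset Printing Implicit Defensive.

Import GRing.Theory.
Local Open Scope ring_scope.
Local Open Scope quotient_scope.

Section Elements.
Variable R : comPzRingType.

Definition nilradical : {pred R} := fun x => `[< exists n, x ^+ n = 0 >].

(* In a nonzero ring this contains 0. *)
Definition zero_divisor : {pred R} :=
  fun x => `[< exists2 y, y != 0 & x * y = 0 >].

Definition regular : {pred R} := fun x => x \notin zero_divisor.

Lemma regularP x : reflect (forall y, x * y = 0 -> y = 0) (x \in regular).
Proof.
apply: (iffP idP) => [/asboolPn xreg y xy0 | xreg].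
  by apply/eqP/negP => /negP y0; apply: xreg; exists y.
by apply/asboolPn => -[y /eqP y0 /xreg].
Qed.

Lemma regular_mulr_closed : mulr_closed regular.
Proof.
split=> [|x y /regularP xreg /regularP yreg].
  by apply/regularP => y; rewrite mul1r.
by apply/regularP => z; rewrite -mulrA => /xreg/yreg.
Qed.

HB.instance Definition _ :=
  GRing.isMulClosed.Build R regular regular_mulr_closed.

Definition principal (x : R) : {pred R} := fun y => `[< exists r, y = r * x >].

End Elements.
Arguments nilradical R : clear implicits.
Arguments zero_divisor R : clear implicits.
Arguments regular R : clear implicits.

Section PhiRing.
Variable R : comNzRingType.

Definition prime_ideal (P : {pred R}) : Prop :=
  idealr_closed P /\ prime_idealr_closed P.

Definition phi_ring : Prop :=
  prime_ideal (nilradical R) /\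
  forall x, x \notin nilradical R ->
    {subset nilradical R <= principal x} /\
    ~ {subset principal x <= nilradical R}.

Definition strong_phi_ring : Prop :=
  phi_ring /\ zero_divisor R =i nilradical R.

End PhiRing.
Arguments phi_ring R : clear implicits.
Arguments strong_phi_ring R : clear implicits.

(* MathComp's {fraction R} only covers integral domains; here R may have zero
   divisors and S is any multiplicative subset, so a/s = b/t iff u(at) = u(bs)
   for some u in S. *)
Section Localization.
Variables (R : comPzRingType) (S : mulrClosed R).

Local Notation frac := (R * {s : R | s \in S})%type.
Implicit Types p q : frac.

Definition loc_equiv p q : bool :=
  `[< exists2 u, u \in S & u * (p.1 * val q.2) = u * (q.1 * val p.2) >].

Lemma loc_equiv_refl : reflexive loc_equiv.
Proof. by move=> p; apply/asboolP; exists 1; rewrite ?rpred1. Qed.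

Lemma loc_equiv_sym : symmetric loc_equiv.
Proof.
by move=> p q; apply/asboolP/asboolP => -[u Su e]; exists u.
Qed.

Lemma loc_equiv_trans : transitive loc_equiv.
Proof.
move=> [b [t St]] [a [s Ss]] [c [w Sw]] /asboolP[u Su /= e] /asboolP[v Sv /= f].
apply/asboolP; exists (u * v * t); rewrite /= ?rpredM //.
transitivity (v * w * (u * (a * t))).
  by rewrite (AC (3*2) (2*5*(1*(4*3)))).
rewrite e (AC (2*(1*2)) (5*3*(1*(4*2)))) /= -[s * u * _]mulrA f.
by rewrite (AC (1*(1*(1*2))) ((2*3*5)*(4*1))).
Qed.

Canonical loc_equiv_rel :=
  EquivRel loc_equiv loc_equiv_refl loc_equiv_sym loc_equiv_trans.

Definition loc := {eq_quot loc_equiv}.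
HB.instance Definition _ : EqQuotient _ loc_equiv loc := EqQuotient.on loc.
HB.instance Definition _ := Choice.on loc.

Lemma loc_eqP p q :
  reflect (exists2 u, u \in S & u * (p.1 * val q.2) = u * (q.1 * val p.2))
          (p == q %[mod loc]).
Proof. by rewrite eqmodE; apply: asboolP. Qed.

Definition den_mul (s t : {s : R | s \in S}) : {s : R | s \in S} :=
  exist _ (val s * val t) (rpredM (valP s) (valP t)).

Definition den1 : {s : R | s \in S} := exist _ 1 (rpred1 S).

Definition frac_add p q : frac :=
  (p.1 * val q.2 + q.1 * val p.2, den_mul p.2 q.2).
Definition frac_opp p : frac := (- p.1, p.2).
Definition frac_mul p q : frac := (p.1 * q.1, den_mul p.2 q.2).

Definition to_loc (x : R) : loc := \pi_loc (x, den1).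

Definition loc_add := lift_op2 loc frac_add.
Definition loc_opp := lift_op1 loc frac_opp.
Definition loc_mul := lift_op2 loc frac_mul.

Lemma loc_repr p : exists2 u, u \in S &
  u * ((repr (\pi_loc p)).1 * val p.2) = u * (p.1 * val (repr (\pi_loc p)).2).
Proof. by apply/loc_eqP; rewrite reprK. Qed.

Lemma pi_loc_add : {morph \pi_loc : p q / frac_add p q >-> loc_add p q}.
Proof.
move=> p q; unlock loc_add; apply/eqP; rewrite eq_sym; apply/loc_eqP.
have [u Su e] := loc_repr p; have [v Sv f] := loc_repr q.
move: (repr _) (repr _) e f => [b t] [a s] /= e f.
exists (u * v); rewrite ?rpredM //=.
transitivity (u * (a * sval p.2) * v * sval q.2 * sval t
              + v * (b * sval q.2) * u * sval p.2 * sval s); first by ring.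
by rewrite e f; ring.
Qed.
Canonical pi_loc_add_morph := PiMorph2 pi_loc_add.

Lemma pi_loc_opp : {morph \pi_loc : p / frac_opp p >-> loc_opp p}.
Proof.
move=> p; unlock loc_opp; apply/eqP; rewrite eq_sym; apply/loc_eqP.
have [u Su e] := loc_repr p; move: (repr _) e => [a s] /= e.
by exists u; rewrite //= !mulNr !mulrN e.
Qed.
Canonical pi_loc_opp_morph := PiMorph1 pi_loc_opp.

Lemma pi_loc_mul : {morph \pi_loc : p q / frac_mul p q >-> loc_mul p q}.
Proof.
move=> p q; unlock loc_mul; apply/eqP; rewrite eq_sym; apply/loc_eqP.
have [u Su e] := loc_repr p; have [v Sv f] := loc_repr q.
move: (repr _) (repr _) e f => [b t] [a s] /= e f.
exists (u * v); rewrite ?rpredM //=.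
transitivity (u * (a * sval p.2) * (v * (b * sval q.2))); first by ring.
by rewrite e f; ring.
Qed.
Canonical pi_loc_mul_morph := PiMorph2 pi_loc_mul.

Let eq_loc p q : p.1 * val q.2 = q.1 * val p.2 -> \pi_loc p = \pi_loc q.
Proof. by move=> e; apply/eqP/loc_eqP; exists 1; rewrite ?rpred1 // e. Qed.

Lemma loc_addA : associative loc_add.
Proof.
elim/quotW=> x; elim/quotW=> y; elim/quotW=> z; rewrite -!pi_loc_add.
by apply: eq_loc => /=; ring.
Qed.

Lemma loc_addC : commutative loc_add.
Proof.
elim/quotW=> x; elim/quotW=> y; rewrite -!pi_loc_add.
by apply: eq_loc => /=; ring.
Qed.

Lemma loc_add0 : left_id (to_loc 0) loc_add.
Proof.
by elim/quotW=> x; rewrite -!pi_loc_add; apply: eq_loc => /=; ring.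
Qed.

Lemma loc_addN : left_inverse (to_loc 0) loc_opp loc_add.
Proof.
elim/quotW=> x; rewrite -pi_loc_opp -pi_loc_add.
by apply: eq_loc => /=; ring.
Qed.

HB.instance Definition _ :=
  GRing.isZmodule.Build loc loc_addA loc_addC loc_add0 loc_addN.

Lemma loc_mulA : associative loc_mul.
Proof.
elim/quotW=> x; elim/quotW=> y; elim/quotW=> z; rewrite -!pi_loc_mul.
by apply: eq_loc => /=; ring.
Qed.

Lemma loc_mulC : commutative loc_mul.
Proof.
elim/quotW=> x; elim/quotW=> y; rewrite -!pi_loc_mul.
by apply: eq_loc => /=; ring.
Qed.

Lemma loc_mul1 : left_id (to_loc 1) loc_mul.
Proof.
by elim/quotW=> x; rewrite -!pi_loc_mul; apply: eq_loc => /=; ring.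
Qed.

Lemma loc_mulD : left_distributive loc_mul loc_add.
Proof.
elim/quotW=> x; elim/quotW=> y; elim/quotW=> z.
rewrite -!(pi_loc_add, pi_loc_mul).
by apply: eq_loc => /=; ring.
Qed.

HB.instance Definition _ :=
  GRing.Zmodule_isComPzRing.Build loc loc_mulA loc_mulC loc_mul1 loc_mulD.

Lemma to_loc_is_zmod_morphism : zmod_morphism to_loc.
Proof.
move=> x y; rewrite /to_loc -[- \pi_loc _]pi_loc_opp.
by rewrite -[RHS]pi_loc_add; apply: eq_loc => /=; ring.
Qed.

Lemma to_loc_is_monoid_morphism : monoid_morphism to_loc.
Proof.
split=> // x y; rewrite /to_loc -[RHS]pi_loc_mul.
by apply: eq_loc => /=; ring.
Qed.

HB.instance Definition _ :=
  GRing.isZmodMorphism.Build R loc to_loc to_loc_is_zmod_morphism.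
HB.instance Definition _ :=
  GRing.isMonoidMorphism.Build R loc to_loc to_loc_is_monoid_morphism.

End Localization.

Definition total_quotient (A : comPzRingType) : comPzRingType :=
  loc (regular A).
Definition to_total (A : comPzRingType) : {rmorphism A -> total_quotient A} :=
  @to_loc A (regular A).

(* The ideals of A are the A-submodules of the regular module A^o. *)
Section Invertible.
Variable A : comPzRingType.
Implicit Types J : submodClosed A^o.

Definition regular_ideal J : Prop := exists2 x, x \in J & x \in regular A.

Definition ideal_inv J (x : total_quotient A) : Prop :=
  forall a, a \in J -> exists b, to_total A a * x = to_total A b.

Definition ideal_mul_inv J (y : total_quotient A) : Prop :=
  exists n (a : 'I_n -> A) (x : 'I_n -> total_quotient A),
    (forall i, a i \in J /\ ideal_inv J (x i)) /\
    y = \sum_(i < n) to_total A (a i) * x i.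

Definition invertible_ideal J : Prop :=
  regular_ideal J /\
  forall y, ideal_mul_inv J y <-> exists b, y = to_total A b.

Definition nonnil_ideal J : Prop := exists2 x, x \in J & x \notin nilradical A.

End Invertible.

Section PhiImage.
Variables (R : comNzRingType) (hR : phi_ring R).

Definition non_nilpotent of phi_ring R : {pred R} :=
  fun x => x \notin nilradical R.

Lemma non_nilpotent_mulr_closed : mulr_closed (non_nilpotent hR).
Proof.
have [[[_ nil1 _] nilP] _] := hR.
split=> // x y xn yn; apply/negP => /nilP.
by case/orP; apply/negP.
Qed.

HB.instance Definition _ :=
  GRing.isMulClosed.Build R (non_nilpotent hR) non_nilpotent_mulr_closed.

Definition loc_nil : comPzRingType := loc (non_nilpotent hR).
Definition to_loc_nil : {rmorphism R -> loc_nil} :=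
  @to_loc R (non_nilpotent hR).

Definition phi_image : {pred loc_nil} :=
  fun y => `[< exists r, to_loc_nil r = y >].

Lemma phi_image_subring_closed : subring_closed phi_image.
Proof.
split=> [|_ _ /asboolP[r <-] /asboolP[s <-]|_ _ /asboolP[r <-] /asboolP[s <-]].
- by apply/asboolP; exists 1; rewrite rmorph1.
- by apply/asboolP; exists (r - s); rewrite rmorphB.
- by apply/asboolP; exists (r * s); rewrite rmorphM.
Qed.

HB.instance Definition _ :=
  GRing.isSubringClosed.Build loc_nil phi_image phi_image_subring_closed.

Definition phiR := {y : loc_nil | y \in phi_image}.
HB.instance Definition _ := SubChoice.on phiR.
HB.instance Definition _ :=
  GRing.SubChoice_isSubComPzRing.Build loc_nil phi_image phiR
    phi_image_subring_closed.

Definition to_phiR (r : R) : phiR :=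
  exist _ (to_loc_nil r) (asboolT (ex_intro _ r erefl)).

Variable I : submodClosed R^o.

Definition phi_ideal : {pred phiR^o} :=
  fun y => `[< exists2 r, r \in I & to_phiR r = y >].

Lemma phi_ideal_submod_closed : submod_closed phi_ideal.
Proof.
split=> [|a _ _ /asboolP[r Ir <-] /asboolP[s Is <-]].
  by apply/asboolP; exists 0; rewrite ?rpred0 //; apply/val_inj/rmorph0.
case: a => a a_phi; have /asboolP[c ca] := a_phi; apply/asboolP.
exists (c * r + s); first by rewrite rpredD // (rpredZ (c : R)).
by apply: val_inj; rewrite /= rmorphD rmorphM /= ca.
Qed.

HB.instance Definition _ :=
  GRing.isSubmodClosed.Build phiR phiR^o phi_ideal phi_ideal_submod_closed.

Definition phi_invertible : Prop :=
  nonnil_ideal I /\ invertible_ideal phi_ideal.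

End PhiImage.

Section Modules.
Variable R : comNzRingType.

Section Submodule.
Variables (M : lmodType R) (S : submodClosed M).

Definition submodule := {x : M | x \in S}.
HB.instance Definition _ := SubChoice.on submodule.
HB.instance Definition _ := [SubChoice_isSubLmodule of submodule by <:].

End Submodule.

Section Quotient.
Variables (M : lmodType R) (S : submodClosed M).

Definition quot_equiv (x y : M) : bool := (x - y) \in S.

Let rpredNS x : x \in S -> - x \in S.
Proof. by rewrite -scaleN1r; apply: rpredZ. Qed.

Lemma quot_equiv_refl : reflexive quot_equiv.
Proof. by move=> x; rewrite /quot_equiv subrr rpred0. Qed.

Lemma quot_equiv_sym : symmetric quot_equiv.
Proof.
by move=> x y; apply/idP/idP => /rpredNS; rewrite opprB.
Qed.

Lemma quot_equiv_trans : transitive quot_equiv.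
Proof.
by move=> y x z xy yz; rewrite /quot_equiv -(subrKA y) rpredD.
Qed.

Canonical quot_equiv_rel :=
  EquivRel quot_equiv quot_equiv_refl quot_equiv_sym quot_equiv_trans.

Definition quot_mod := {eq_quot quot_equiv}.
HB.instance Definition _ : EqQuotient _ quot_equiv quot_mod :=
  EqQuotient.on quot_mod.
HB.instance Definition _ := Choice.on quot_mod.

Lemma quot_eqP x y : reflect (x = y %[mod quot_mod]) (x - y \in S).
Proof. by apply: (iffP idP) => [h|/eqmodP//]; apply/eqmodP. Qed.

Let quot_reprP x : x - repr (\pi_quot_mod x) \in S.
Proof. by apply/quot_eqP; rewrite reprK. Qed.

Definition quot_add := lift_op2 quot_mod (@GRing.add M).
Definition quot_opp := lift_op1 quot_mod (@GRing.opp M).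
Definition quot_scale (a : R) := lift_op1 quot_mod (@GRing.scale R M a).

Lemma pi_quot_add : {morph \pi_quot_mod : x y / x + y >-> quot_add x y}.
Proof.
by move=> x y; unlock quot_add; apply/quot_eqP; rewrite opprD addrACA rpredD.
Qed.

Lemma pi_quot_opp : {morph \pi_quot_mod : x / - x >-> quot_opp x}.
Proof.
by move=> x; unlock quot_opp; apply/quot_eqP; rewrite -opprD rpredNS.
Qed.

Lemma pi_quot_scale a : {morph \pi_quot_mod : x / a *: x >-> quot_scale a x}.
Proof.
by move=> x; unlock quot_scale; apply/quot_eqP; rewrite -scalerBr rpredZ.
Qed.

Lemma quot_addA : associative quot_add.
Proof.
by elim/quotW=> x; elim/quotW=> y; elim/quotW=> z; rewrite -!pi_quot_add addrA.
Qed.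

Lemma quot_addC : commutative quot_add.
Proof. by elim/quotW=> x; elim/quotW=> y; rewrite -!pi_quot_add addrC. Qed.

Lemma quot_add0 : left_id (\pi_quot_mod 0) quot_add.
Proof. by elim/quotW=> x; rewrite -pi_quot_add add0r. Qed.

Lemma quot_addN : left_inverse (\pi_quot_mod 0) quot_opp quot_add.
Proof. by elim/quotW=> x; rewrite -pi_quot_opp -pi_quot_add addNr. Qed.

HB.instance Definition _ :=
  GRing.isZmodule.Build quot_mod quot_addA quot_addC quot_add0 quot_addN.

Lemma quot_scaleA a b x : quot_scale a (quot_scale b x) = quot_scale (a * b) x.
Proof. by elim/quotW: x => x; rewrite -!pi_quot_scale scalerA. Qed.

Lemma quot_scale1 : left_id 1 quot_scale.
Proof. by elim/quotW=> x; rewrite -pi_quot_scale scale1r. Qed.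

Lemma quot_scaleDr : right_distributive quot_scale +%R.
Proof.
move=> a; elim/quotW=> x; elim/quotW=> y.
rewrite -[LHS]/(quot_scale a (quot_add _ _)) -pi_quot_add -pi_quot_scale.
by rewrite scalerDr pi_quot_add !pi_quot_scale.
Qed.

Lemma quot_scaleDl x : {morph quot_scale^~ x : a b / a + b}.
Proof.
move=> a b; elim/quotW: x => x.
by rewrite -pi_quot_scale scalerDl pi_quot_add !pi_quot_scale.
Qed.

HB.instance Definition _ :=
  GRing.Zmodule_isLmodule.Build R quot_mod
    quot_scaleA quot_scale1 quot_scaleDr quot_scaleDl.

Definition quot_pi (x : M) : quot_mod := \pi_quot_mod x.

Lemma quot_pi_is_linear : linear quot_pi.
Proof. by move=> a x y; rewrite /quot_pi pi_quot_add pi_quot_scale. Qed.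

HB.instance Definition _ :=
  GRing.isLinear.Build R M quot_mod _ quot_pi quot_pi_is_linear.

End Quotient.

Section KernelImage.
Variables (M N : lmodType R) (f : {linear M -> N}).

Definition ker_lin : {pred M} := fun x => f x == 0.

Lemma ker_lin_submod_closed : submod_closed ker_lin.
Proof.
split=> [|a x y]; rewrite !unfold_in ?linear0 // => /eqP fx /eqP fy.
by rewrite linearP fx fy scaler0 addr0.
Qed.

HB.instance Definition _ :=
  GRing.isSubmodClosed.Build R M ker_lin ker_lin_submod_closed.

Definition im_lin : {pred N} := fun y => `[< exists x, f x = y >].

End KernelImage.

(* The homology of A --f--> B --g--> C at B. *)
Section Homology.
Variables (A B C : lmodType R) (f : {linear A -> B}) (g : {linear B -> C}).

Definition boundary : {pred submodule (ker_lin g)} :=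
  fun x => val x \in im_lin f.

Lemma boundary_submod_closed : submod_closed boundary.
Proof.
split=> [|a x y /asboolP[u fu] /asboolP[v fv]].
  by apply/asboolP; exists 0; rewrite linear0.
by apply/asboolP; exists (a *: u + v); rewrite linearP fu fv.
Qed.

HB.instance Definition _ :=
  GRing.isSubmodClosed.Build R (submodule (ker_lin g)) boundary
    boundary_submod_closed.

Definition homology : lmodType R := quot_mod boundary.

End Homology.

Section Span.
Variable M : lmodType R.

Definition submod_span (X : M -> Prop) : {pred M} :=
  fun x => `[< forall S : submodClosed M,
         (forall y, X y -> y \in S) -> x \in S >].

Lemma submod_span_closed X : submod_closed (submod_span X).
Proof.
split=> [|a x y /asboolP hx /asboolP hy]; apply/asboolP => S XS.
  exact: rpred0.
by rewrite rpredD ?rpredZ ?hx ?hy.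
Qed.

HB.instance Definition _ X :=
  GRing.isSubmodClosed.Build R M (submod_span X) (submod_span_closed X).

End Span.

Section Free.
Variables (K : choiceType) (M : lmodType R) (f : K -> M).

Definition free_gen (k : K) : {malg R[K]} := mkmalgU k 1.

Definition free_lift (x : {malg R[K]}) : M :=
  \sum_(k <- msupp x) mcoeff k x *: f k.

Lemma free_liftEw (x : {malg R[K]}) (D : {fset K}) :
  fsubset (msupp x) D -> free_lift x = \sum_(k <- D) mcoeff k x *: f k.
Proof.
move=> xD; rewrite /free_lift [RHS](big_fsetID _ (mem (msupp x))) /=.
rewrite [X in _ = _ + X]big1_fset ?addr0; last first.
  by move=> k; rewrite !inE => /andP[_ /mcoeff_outdom ->]; rewrite scale0r.
congr (\sum_(k <- enum_fset _) _); apply/fsetP => k; rewrite !inE andbC.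
by case: (boolP (k \in msupp x)) => // /(fsubsetP xD) ->.
Qed.

Lemma free_lift_is_linear : linear free_lift.
Proof.
move=> a x y.
pose D := fsetU (msupp (a *: x + y)) (fsetU (msupp x) (msupp y)).
rewrite (@free_liftEw _ D) ?fsubsetUl //.
rewrite (@free_liftEw x D); last first.
  by rewrite fsubsetU // fsubsetUl orbT.
rewrite (@free_liftEw y D); last first.
  by rewrite fsubsetU // fsubsetUr orbT.
rewrite scaler_sumr -big_split; apply: eq_bigr => k _ /=.
by rewrite mcoeffD mcoeffZ scalerDl scalerA.
Qed.

HB.instance Definition _ :=
  GRing.isLinear.Build R {malg R[K]} M _ free_lift free_lift_is_linear.

Lemma free_lift_gen k : free_lift (free_gen k) = f k.
Proof.
rewrite (@free_liftEw _ [fset k]%fset) ?msuppU_le //.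
by rewrite big_seq_fset1 mcoeffUU scale1r.
Qed.

End Free.

Section Tensor.
Variables A B : lmodType R.

Local Notation gen := (@free_gen (A * B)%type).

Inductive tensor_rel : {malg R[(A * B)%type]} -> Prop :=
| TensorDl a a' b : tensor_rel (gen (a + a', b) - gen (a, b) - gen (a', b))
| TensorDr a b b' : tensor_rel (gen (a, b + b') - gen (a, b) - gen (a, b'))
| TensorZl r a b : tensor_rel (gen (r *: a, b) - r *: gen (a, b))
| TensorZr r a b : tensor_rel (gen (a, r *: b) - r *: gen (a, b)).

Definition tensor : lmodType R := quot_mod (submod_span tensor_rel).

Definition tens (a : A) (b : B) : tensor :=
  quot_pi (submod_span tensor_rel) (gen (a, b)).

End Tensor.

Section TensorTheory.
Variables A B : lmodType R.

Lemma submod_spanP (M : lmodType R) (X : M -> Prop) x :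
  X x -> x \in submod_span X.
Proof. by move=> Xx; apply/asboolP => S; apply. Qed.

Let tens_eq (z : {malg R[(A * B)%type]}) :
  tensor_rel z -> quot_pi (submod_span (@tensor_rel A B)) z = 0.
Proof.
by move=> Xz; apply/quot_eqP; rewrite subr0; apply: submod_spanP.
Qed.

Lemma tensDl (a a' : A) (b : B) : tens (a + a') b = tens a b + tens a' b.
Proof.
by have /eqP := tens_eq (TensorDl a a' b);
   rewrite !linearB -addrA -opprD subr_eq0 => /eqP.
Qed.

Lemma tensDr (a : A) (b b' : B) : tens a (b + b') = tens a b + tens a b'.
Proof.
by have /eqP := tens_eq (TensorDr a b b');
   rewrite !linearB -addrA -opprD subr_eq0 => /eqP.
Qed.

Lemma tensZl r (a : A) (b : B) : tens (r *: a) b = r *: tens a b.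
Proof.
by have /eqP := tens_eq (TensorZl r a b);
   rewrite linearB linearZ subr_eq0 => /eqP.
Qed.

Lemma tensZr r (a : A) (b : B) : tens a (r *: b) = r *: tens a b.
Proof.
by have /eqP := tens_eq (TensorZr r a b);
   rewrite linearB linearZ subr_eq0 => /eqP.
Qed.

End TensorTheory.

(* f (x) M; see tensor_map_tens. *)
Section TensorMap.
Variables (A B M : lmodType R) (f : {linear A -> B}).

Definition tensor_map0 : {linear {malg R[(A * M)%type]} -> tensor B M} :=
  free_lift (fun p : A * M => tens (f p.1) p.2).

Definition tensor_map (t : tensor A M) : tensor B M := tensor_map0 (repr t).

Let tensor_map0_rel z :
  z \in submod_span (@tensor_rel A M) -> tensor_map0 z = 0.
Proof.
move=> /asboolP/(_ (ker_lin tensor_map0)) hz; apply/eqP/hz => {z hz} z.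
move=> zrel; apply/eqP; case: zrel => *.
- by rewrite !linearB /= !free_lift_gen /= linearD tensDl -addrA -opprD subrr.
- by rewrite !linearB /= !free_lift_gen /= tensDr -addrA -opprD subrr.
- by rewrite linearB linearZ /= !free_lift_gen /= linearZ tensZl subrr.
- by rewrite linearB linearZ /= !free_lift_gen /= tensZr subrr.
Qed.

Let tensor_map_pi z : tensor_map (quot_pi _ z) = tensor_map0 z.
Proof.
apply/eqP; rewrite -subr_eq0 -linearB; apply/eqP/tensor_map0_rel.
by apply/quot_eqP; rewrite reprK.
Qed.

Lemma tensor_map_tens a m : tensor_map (tens a m) = tens (f a) m.
Proof. by rewrite tensor_map_pi /= free_lift_gen. Qed.

Lemma tensor_map_is_linear : linear tensor_map.
Proof.
move=> a; elim/quotW=> x; elim/quotW=> y.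
rewrite -[\pi x]/(quot_pi _ x) -[\pi y]/(quot_pi _ y).
by rewrite -linearP !tensor_map_pi linearP.
Qed.

HB.instance Definition _ :=
  GRing.isLinear.Build R (tensor A M) (tensor B M) _ tensor_map
    tensor_map_is_linear.

End TensorMap.
Arguments tensor_map {A B} M f t.

Section Hom.
Variables P M : lmodType R.

Definition linear_fun : {pred P -> M} := fun f => `[< linear f >].

Lemma linear_fun_submod_closed : submod_closed linear_fun.
Proof.
split=> [|a f g /asboolP flin /asboolP glin]; apply/asboolP => b x y /=.
  by rewrite scaler0 addr0.
rewrite -![(_ + _) _]/(_ + _) -![(_ *: _) _]/(_ *: _) flin glin.
by rewrite !scalerDr addrACA !scalerA mulrC.
Qed.

HB.instance Definition _ :=
  GRing.isSubmodClosed.Build R (P -> M) linear_fun linear_fun_submod_closed.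

Definition hom : lmodType R := submodule linear_fun.

End Hom.

(* Hom(d, M) : Hom(Q, M) -> Hom(P, M) *)
Section HomMap.
Variables (P Q M : lmodType R) (d : {linear P -> Q}).

Lemma comp_linear_fun (f : Q -> M) :
  f \in @linear_fun Q M -> f \o d \in @linear_fun P M.
Proof.
by move=> /asboolP flin; apply/asboolP => a x y; rewrite /= linearP flin.
Qed.

Definition hom_map (f : hom Q M) : hom P M :=
  exist _ (val f \o d) (comp_linear_fun (valP f)).

Lemma hom_map_is_linear : linear hom_map.
Proof. by move=> a f g; apply: val_inj. Qed.

HB.instance Definition _ :=
  GRing.isLinear.Build R (hom Q M) (hom P M) _ hom_map hom_map_is_linear.

End HomMap.
Arguments hom_map {P Q} M d f.

(* The canonical free resolution
     ... -> R^(syzygy (syzygy T)) -> R^(syzygy T) -> R^(T) -> T -> 0. *)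
Section FreeResolution.

Definition free_module (M : lmodType R) : lmodType R := {malg R[M]}.

Definition free_cover (M : lmodType R) : {linear free_module M -> M} :=
  free_lift (@id M).

Definition syzygy (M : lmodType R) : lmodType R :=
  submodule (ker_lin (free_cover M)).

Definition free_diff (M : lmodType R) : 
    {linear free_module (syzygy M) -> free_module M} :=
  (val : submodule (ker_lin (free_cover M)) -> _) \o free_cover (syzygy M).

End FreeResolution.

Definition Ext1 (T M : lmodType R) : lmodType R :=
  homology (hom_map M (free_diff T)) (hom_map M (free_diff (syzygy T))).

Definition Tor1 (T M : lmodType R) : lmodType R :=
  homology (tensor_map M (free_diff (syzygy T))) (tensor_map M (free_diff T)).

Definition zero_module (M : lmodType R) : Prop := forall x : M, x = 0.

Definition surjective (M N : lmodType R) (f : M -> N) : Prop :=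
  forall y, exists x, f x = y.

Definition projective (P : lmodType R) : Prop :=
  forall (M N : lmodType R) (g : {linear M -> N}) (f : {linear P -> N}),
    surjective g -> exists h : {linear P -> M}, g \o h =1 f.

Definition injective_module (E : lmodType R) : Prop :=
  forall (M N : lmodType R) (g : {linear M -> N}) (f : {linear M -> E}),
    injective g -> exists h : {linear N -> E}, h \o g =1 f.

Definition flat (M : lmodType R) : Prop :=
  forall (A B : lmodType R) (f : {linear A -> B}),
    injective f -> injective (tensor_map M f).

Definition finitely_generated (M : lmodType R) : Prop :=
  exists s : seq M, forall x, x \in submod_span (fun y => y \in s).

Definition finitely_presented (M : lmodType R) : Prop :=
  exists n (f : {linear 'rV[R]_n -> M}),
    surjective f /\ finitely_generated (submodule (ker_lin f)).

Definition divisible (E : lmodType R) : Prop :=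
  forall s, s \in regular R -> forall e : E, exists e', s *: e' = e.

Definition h_divisible (M : lmodType R) : Prop :=
  exists (E : lmodType R) (f : {linear E -> M}),
    injective_module E /\ surjective f.

Definition phi_torsion (T : lmodType R) : Prop :=
  forall x : T, exists I : submodClosed R^o,
    nonnil_ideal I /\ forall r : R, r \in I -> r *: x = 0.

Definition nonnil_FP_injective (M : lmodType R) : Prop :=
  forall T : lmodType R, finitely_presented T -> phi_torsion T ->
    zero_module (Ext1 T M).

Definition phi_flat (M : lmodType R) : Prop :=
  forall T : lmodType R, phi_torsion T -> zero_module (Tor1 T M).

Definition phi_flat_preenvelope (M F : lmodType R) (f : {linear M -> F})
    : Prop :=
  phi_flat F /\
  forall (F' : lmodType R) (f' : {linear M -> F'}), phi_flat F' ->
    exists g : {linear F -> F'}, f' =1 g \o f.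

Definition phi_flat_envelope (M F : lmodType R) (f : {linear M -> F}) : Prop :=
  phi_flat_preenvelope f /\
  forall g : {linear F -> F}, g \o f =1 f -> bijective g.

End Modules.

Definition phi_Prufer (R : comNzRingType) (hR : phi_ring R) : Prop :=
  forall I : submodClosed R^o,
    finitely_generated (submodule I) -> nonnil_ideal I -> phi_invertible hR I.

(* Main.v *)
(** Call [nonnil_dual_basis] the property that every finitely generated nonnil
    ideal has a finite dual basis; every listed condition is compared with it.
    It makes non-nilpotent elements regular, and peeling off one coordinate at a
    time it gives a dual basis to every finitely generated submodule K of R^n
    containing s R^n with s non-nilpotent.  For such K, a map from K to a
    divisible module extends to R^n, and K (x) M -> R^n (x) M is injective when
    no non-nilpotent element kills a nonzero element of M.  Hence divisible
    modules are nonnil-FP-injective, and the phi-flat modules are exactly the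
    torsion-free ones, which makes (6)-(9) immediate (the envelope of M is M
    modulo torsion).

    Conversely, (3) is applied to E / ker f, where f : R^n -> I is onto and E is
    an injective module containing R^n: extending I ~ R^n / ker f -> E / ker f
    to R splits f.  From flatness, if I = (a_1, ..., a_n) contains s, then
    (a_1, ..., a_n) (x) s vanishes in (R/s)^n (x) I, so that s = sum c_l y_l
    with y_l in I and c_l I <= s R: the maps x |-> c_l x / s form a dual basis.
    Every module involved here is phi-torsion, so phi-flatness suffices. *)

Require Import Defs.
From HB Require Import structures.
From mathcomp Require Import all_boot all_algebra.
From mathcomp Require Import generic_quotient finmap monalg.
From mathcomp Require Import boolp classical_sets functions.

Set Implicit Arguments.
Unset Strict Implicit.
Unset Printing Implicit Defensive.

Import GRing.Theory.
Local Open Scope ring_scope.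

(** * Linear maps, spans and generators *)

Arguments tensor_map {R A B} M f t.
Arguments hom_map {R P Q} M d f.

Section LinearMaps.
Variable R : comNzRingType.

Definition lin_of (M N : lmodType R) (f : M -> N) (fL : linear f) :
    {linear M -> N} :=
  HB.pack f (GRing.isLinear.Build R M N _ f fL).

Lemma im_lin_submod_closed (M N : lmodType R) (f : {linear M -> N}) :
  submod_closed (im_lin f).
Proof.
split=> [|a _ _ /asboolP[x <-] /asboolP[y <-]]; apply/asboolP.
  by exists 0; rewrite linear0.
by exists (a *: x + y); rewrite linearP.
Qed.

HB.instance Definition _ (M N : lmodType R) (f : {linear M -> N}) :=
  GRing.isSubmodClosed.Build R N (im_lin f) (im_lin_submod_closed f).

Lemma smul_linear (M : lmodType R) (c : R) : linear (fun x : M => c *: x).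
Proof. by move=> a x y; rewrite scalerDr !scalerA mulrC. Qed.
Definition smul (M : lmodType R) (c : R) : {linear M -> M} :=
  lin_of (@smul_linear M c).

Lemma act_linear (M : lmodType R) (b : M) : linear (fun r : R^o => r *: b).
Proof. by move=> a x y; rewrite scalerDl scalerA. Qed.
Definition act (M : lmodType R) (b : M) : {linear R^o -> M} :=
  lin_of (act_linear b).

Lemma act_im (M : lmodType R) (b : M) r : r *: b \in im_lin (act b).
Proof. by apply/asboolP; exists r. Qed.

Lemma cyclic_self (M : lmodType R) (b : M) : b \in im_lin (act b).
Proof. by rewrite -[b in b \in _]scale1r act_im. Qed.

Definition principal_ideal (s : R) : submodClosed R^o := im_lin (act (s : R^o)).

Lemma lift_linear (M N : lmodType R) (S : submodClosed N) (f : {linear M -> N})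
    (fS : forall x, f x \in S) :
  linear (fun x => exist _ (f x) (fS x) : submodule S).
Proof. by move=> a x y; apply: val_inj; rewrite /= linearP. Qed.
Definition lift_sub (M N : lmodType R) (S : submodClosed N)
    (f : {linear M -> N}) (fS : forall x, f x \in S) :
    {linear M -> submodule S} :=
  lin_of (lift_linear fS).

Definition sub_incl (M : lmodType R) (S : submodClosed M) :
    {linear submodule S -> M} := (val : submodule S -> M).

Lemma sub_incl_inj (M : lmodType R) (S : submodClosed M) :
  injective (sub_incl S).
Proof. exact: val_inj. Qed.

Definition sub_elt (M : lmodType R) (S : submodClosed M) x (xS : x \in S) :
    submodule S := exist _ x xS.

Lemma sub_inclK (M : lmodType R) (S : submodClosed M) (x0 : submodule S) x :
  x \in S -> sub_incl S (insubd x0 x) = x.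
Proof. exact: insubdK. Qed.

Lemma quot_pi_eq0 (M : lmodType R) (S : submodClosed M) x :
  (quot_pi S x = 0) <-> (x \in S).
Proof.
split=> [h|xS]; last by apply/quot_eqP; rewrite subr0.
by have /quot_eqP := (h : quot_pi S x = quot_pi S 0); rewrite subr0.
Qed.

Lemma quot_piK (M : lmodType R) (S : submodClosed M) (x : quot_mod S) :
  quot_pi S (repr x) = x.
Proof. exact: reprK. Qed.

Lemma quot_lift (M N : lmodType R) (S : submodClosed M) (f : {linear M -> N}) :
    (forall x, x \in S -> f x = 0) ->
  exists g : {linear quot_mod S -> N}, forall x, g (quot_pi S x) = f x.
Proof.
move=> fS; have gE x : f (repr (quot_pi S x)) = f x.
  apply/eqP; rewrite -subr_eq0 -linearB; apply/eqP/fS/quot_pi_eq0.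
  by rewrite linearB /= quot_piK subrr.
have gL : linear (fun x : quot_mod S => f (repr x)).
  move=> a x y; rewrite -[x]quot_piK -[y]quot_piK -linearP !gE.
  by rewrite linearP.
by exists (lin_of gL).
Qed.

Lemma malgE (K : choiceType) (x : {malg R[K]}) :
  x = \sum_(k <- msupp x) mcoeff k x *: free_gen R k.
Proof.
rewrite {1}[x]monalgE; apply: eq_bigr => k _.
by apply/malgP => l; rewrite mcoeffZ !mcoeffU mulr_natr.
Qed.

Lemma free_ext (K : choiceType) (M : lmodType R)
    (f g : {linear {malg R[K]} -> M}) :
  (forall k, f (free_gen R k) = g (free_gen R k)) -> f =1 g.
Proof.
move=> fg x; rewrite [x]malgE !linear_sum.
by apply: eq_bigr => k _; rewrite !linearZ /= fg.
Qed.

Lemma coef_linear (K : choiceType) (k : K) :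
  linear (fun x : {malg R[K]} => mcoeff k x : R^o).
Proof. by move=> a x y; rewrite mcoeffD mcoeffZ. Qed.
Definition coef (K : choiceType) (k : K) : {linear {malg R[K]} -> R^o} :=
  lin_of (coef_linear k).

Lemma coef_gen (K : choiceType) (k l : K) :
  coef k (free_gen R l) = (l == k)%:R.
Proof. by rewrite /= mcoeffU. Qed.

Lemma span_sum (M : lmodType R) (X : M -> Prop) x :
    x \in submod_span X ->
  exists2 l : seq (R * M), (forall q, q \in l -> X q.2) &
    x = \sum_(q <- l) q.1 *: q.2.
Proof.
pose P := fun x : M => `[< exists2 l : seq (R * M),
  (forall q, q \in l -> X q.2) & x = \sum_(q <- l) q.1 *: q.2 >].
have Pcl : submod_closed (P : {pred M}).
  split=> [|a _ _ /asboolP[l lX ->] /asboolP[m mX ->]]; apply/asboolP.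
    by exists [::]; rewrite ?big_nil.
  exists ([seq (a * q.1, q.2) | q <- l] ++ m) => [q|].
    by rewrite mem_cat => /orP[/mapP[q' /lX ? ->]|/mX].
  rewrite big_cat big_map scaler_sumr; congr (_ + _).
  by apply: eq_bigr => q _; rewrite scalerA.
pose Pm : submodClosed M := HB.pack (P : {pred M}) (GRing.isSubmodClosed.Build
  R M P Pcl).
move=> /asboolP/(_ Pm) h; apply/asboolP/h => y Xy.
apply/asboolP; exists [:: (1, y)]; last by rewrite big_seq1 scale1r.
by move=> q; rewrite inE => /eqP->.
Qed.

Lemma span_ind (M : lmodType R) (X : M -> Prop) (P : M -> Prop) :
    P 0 -> (forall a x y, P x -> P y -> P (a *: x + y)) ->
    (forall x, X x -> P x) ->
  forall x, x \in submod_span X -> P x.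
Proof.
move=> P0 PD PX x /span_sum[l lX ->].
elim: l lX => [|q l IH] lX; first by rewrite big_nil.
rewrite big_cons; apply: PD; first by apply/PX/lX/mem_head.
by apply: IH => y ly; apply: lX; rewrite inE ly orbT.
Qed.

Lemma fg_image (M N : lmodType R) (f : {linear M -> N}) :
  surjective f -> finitely_generated M -> finitely_generated N.
Proof.
move=> fsurj [s sM]; exists (map f s) => y; have [x <-] := fsurj y.
move: x (sM x); apply: span_ind => [|a x z xs zs|x xs].
- by rewrite linear0 rpred0.
- by rewrite linearP rpredD ?rpredZ.
- exact/submod_spanP/map_f.
Qed.

Lemma fg_span (M : lmodType R) (s : seq M) :
  finitely_generated (submodule (submod_span (fun x => x \in s))).
Proof.
set S : submodClosed M := submod_span _.
have sS x : x \in s -> x \in S by move=> xs; apply: submod_spanP.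
exists (map (insubd (0 : submodule S)) s) => -[x xS].
have [l ls xE] := span_sum xS.
have -> : exist _ x xS = \sum_(q <- l) q.1 *: insubd (0 : submodule S) q.2.
  apply: val_inj; rewrite -[RHS]/(sub_incl S _) linear_sum [LHS]xE.
  rewrite big_seq [RHS]big_seq; apply: eq_bigr => q /ls/sS qS.
  by rewrite linearZ sub_inclK.
rewrite big_seq; apply: rpred_sum => q /ls qs.
exact/rpredZ/submod_spanP/map_f.
Qed.

End LinearMaps.

(** * Tensor products *)

Section TensorProducts.
Variable R : comNzRingType.

Definition bilinear_map (A B C : lmodType R) (f : A -> B -> C) : Prop :=
  (forall b, linear (f^~ b)) /\ (forall a, linear (f a)).

Lemma tensor_lift (A B C : lmodType R) (f : A -> B -> C) : bilinear_map f ->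
  exists g : {linear tensor A B -> C}, forall a b, g (tens a b) = f a b.
Proof.
move=> [fl fr]; pose f1 b := lin_of (fl b); pose f2 a := lin_of (fr a).
pose F : {linear {malg R[(A * B)%type]} -> C} :=
  free_lift (fun p : A * B => f p.1 p.2).
have FE a b : F (free_gen R (a, b)) = f a b by rewrite /F /= free_lift_gen.
have [|g gE] := @quot_lift R _ _ (submod_span (@tensor_rel R A B)) F.
  apply: span_ind => [|a x y Fx Fy|x]; first by rewrite linear0.
    by rewrite linearP Fx Fy scaler0 addr0.
  case=> *; rewrite !linearB ?[F (_ *: _)]linearZ !FE.
  - by apply/eqP; rewrite -addrA -opprD subr_eq0; apply/eqP/(linearD (f1 _)).
  - by apply/eqP; rewrite -addrA -opprD subr_eq0; apply/eqP/(linearD (f2 _)).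
  - by apply/eqP; rewrite subr_eq0; apply/eqP; rewrite [LHS](linearZ_LR (f1 _)).
  - by apply/eqP; rewrite subr_eq0; apply/eqP; rewrite [LHS](linearZ_LR (f2 _)).
by exists g => a b; rewrite /tens gE FE.
Qed.

Lemma tens_linearl (A B : lmodType R) (b : B) : linear (fun a : A => tens a b).
Proof. by move=> r x y; rewrite tensDl tensZl. Qed.
Lemma tens_linearr (A B : lmodType R) (a : A) : linear (fun b : B => tens a b).
Proof. by move=> r x y; rewrite tensDr tensZr. Qed.
Definition tensl (A B : lmodType R) (b : B) : {linear A -> tensor A B} :=
  lin_of (@tens_linearl A B b).
Definition tensr (A B : lmodType R) (a : A) : {linear B -> tensor A B} :=
  lin_of (@tens_linearr A B a).

Lemma tens0l (A B : lmodType R) (b : B) : tens (0 : A) b = 0.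
Proof. exact: (linear0 (tensl A b)). Qed.
Lemma tens0r (A B : lmodType R) (a : A) : tens a (0 : B) = 0.
Proof. exact: (linear0 (tensr B a)). Qed.
Lemma tensBl (A B : lmodType R) (a a' : A) (b : B) :
  tens (a - a') b = tens a b - tens a' b.
Proof. exact: (linearB (tensl A b)). Qed.
Lemma tensNl (A B : lmodType R) (a : A) (b : B) : tens (- a) b = - tens a b.
Proof. exact: (linearN (tensl A b)). Qed.

Lemma tensor_sum (A B : lmodType R) (t : tensor A B) :
  exists l : seq (A * B), t = \sum_(q <- l) tens q.1 q.2.
Proof.
have [x <-] : exists x, quot_pi (submod_span (@tensor_rel R A B)) x = t.
  by exists (repr t); apply: quot_piK.
exists [seq (mcoeff k x *: k.1, k.2) | k <- msupp x].
rewrite big_map {1}[x]malgE linear_sum; apply: eq_bigr => -[a b] _.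
by rewrite linearZ tensZl.
Qed.

Lemma tensor_sum_sub (A M : lmodType R) (S : submodClosed A)
    (l : seq (A * M)) : (forall q, q \in l -> q.1 \in S) ->
  tensor_map M (sub_incl S)
    (\sum_(q <- l) tens (insubd (0 : submodule S) q.1) q.2) =
  \sum_(q <- l) tens q.1 q.2.
Proof.
move=> lS; rewrite linear_sum big_seq [RHS]big_seq; apply: eq_bigr => q ql.
by rewrite /= tensor_map_tens sub_inclK ?lS.
Qed.

Lemma tensor_ext (A B C : lmodType R) (f g : {linear tensor A B -> C}) :
  (forall a b, f (tens a b) = g (tens a b)) -> f =1 g.
Proof.
move=> fg t; have [l ->] := tensor_sum t.
by rewrite !linear_sum; apply: eq_bigr => q _; apply: fg.
Qed.

Lemma tensor_mapr (A M N : lmodType R) (f : {linear M -> N}) :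
  exists g : {linear tensor A M -> tensor A N},
    forall a m, g (tens a m) = tens a (f m).
Proof.
apply: tensor_lift; split=> [b|a] r x y.
  by rewrite tensDl tensZl.
by rewrite linearP tensDr tensZr.
Qed.

Lemma linear_inj (M N : lmodType R) (f : {linear M -> N}) :
  (forall x, f x = 0 -> x = 0) -> injective f.
Proof.
move=> f0 x y fxy; apply/eqP; rewrite -subr_eq0; apply/eqP/f0.
by rewrite linearB fxy subrr.
Qed.

Lemma inj_eq0 (M N : lmodType R) (f : {linear M -> N}) x :
  injective f -> f x = 0 -> x = 0.
Proof. by move=> finj; rewrite -[0](linear0 f) => /finj. Qed.

Lemma tensor_map_retract (A B M N : lmodType R) (f : {linear A -> B})
    (i : {linear M -> N}) (j : {linear N -> M}) : cancel i j ->
  injective (tensor_map N f) -> injective (tensor_map M f).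
Proof.
move=> ij finj; apply: linear_inj => t ft0.
have [iA iAE] := tensor_mapr A i; have [iB iBE] := tensor_mapr B i.
have [jA jAE] := tensor_mapr A j.
have jAK : jA (iA t) = t.
  pose jiA : {linear _ -> _} := jA \o iA.
  by apply: (@tensor_ext _ _ _ jiA idfun) => a m /=; rewrite iAE jAE ij.
have comm : tensor_map N f (iA t) = iB (tensor_map M f t).
  pose g1 : {linear _ -> _} := tensor_map N f \o iA.
  pose g2 : {linear _ -> _} := iB \o tensor_map M f.
  apply: (@tensor_ext _ _ _ g1 g2) => a m /=.
  by rewrite iAE !tensor_map_tens iBE.
have /(inj_eq0 finj) iAt0 : tensor_map N f (iA t) = 0.
  by rewrite comm ft0 linear0.
by rewrite -jAK iAt0 linear0.
Qed.

Lemma tensor_map_comp (A B C M : lmodType R) (f : {linear A -> B})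
    (g : {linear B -> C}) (h : {linear A -> C}) t : h =1 g \o f ->
  tensor_map M h t = tensor_map M g (tensor_map M f t).
Proof.
move=> hE; pose gf : {linear _ -> _} := tensor_map M g \o tensor_map M f.
apply: (@tensor_ext _ _ _ (tensor_map M h) gf) => a m /=.
by rewrite !tensor_map_tens hE.
Qed.

Lemma tensor_map_surj (A B M : lmodType R) (f : {linear A -> B}) :
  surjective f -> surjective (tensor_map M f).
Proof.
move=> fsurj t; have [l ->] := tensor_sum t.
elim: l => [|[b m] l [t' IH]]; first by exists 0; rewrite big_nil linear0.
have [a ab] := fsurj b; exists (tens a m + t').
by rewrite linearD /= tensor_map_tens ab IH big_cons.
Qed.

Lemma tensor_right_exact (A B M : lmodType R) (f : {linear A -> B}) t :
    surjective f -> tensor_map M f t = 0 ->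
  exists u, tensor_map M (sub_incl (ker_lin f)) u = t.
Proof.
move=> fsurj; have [g gK] := choice fsurj.
pose D := im_lin (tensor_map M (sub_incl (ker_lin f))).
pose h (b : B) (m : M) := quot_pi D (tens (g b) m).
have hE a m : h (f a) m = quot_pi D (tens a m).
  apply/eqP; rewrite -subr_eq0 -linearB; apply/eqP/quot_pi_eq0/asboolP.
  have k : g (f a) - a \in ker_lin f.
    by apply/eqP; rewrite linearB gK subrr.
  exists (tens (sub_elt k) m).
  by rewrite /= tensor_map_tens -tensBl.
have hbil : bilinear_map h.
  split=> [m|b] r x y.
    rewrite -[x]gK -[y]gK -linearP !hE.
    by rewrite tensDl tensZl linearP.
  by rewrite /h tensDr tensZr linearP.
have [L LE] := tensor_lift hbil => ft0.
have /quot_pi_eq0/asboolP : quot_pi D t = 0; last by [].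
transitivity (L (tensor_map M f t)); last by rewrite ft0 linear0.
pose Lf : {linear _ -> _} := L \o tensor_map M f.
apply: (@tensor_ext _ _ _ (quot_pi D) Lf) => a m /=.
by rewrite tensor_map_tens LE hE.
Qed.

End TensorProducts.

(** * Tor and flatness *)

Section Flatness.
Variable R : comNzRingType.

Lemma homology_zero (A B C : lmodType R) (f : {linear A -> B})
    (g : {linear B -> C}) :
  zero_module (homology f g) <-> forall x, g x = 0 -> exists u, f u = x.
Proof.
split=> [h x /eqP gx|h x].
  by have /quot_pi_eq0/asboolP :=
    h (quot_pi _ (sub_elt (gx : x \in ker_lin g))).
rewrite -[x]quot_piK; apply/quot_pi_eq0/asboolP/h/eqP.
exact: (valP (repr x)).
Qed.

Lemma free_cover_gen (T : lmodType R) x : free_cover T (free_gen R x) = x.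
Proof. exact: free_lift_gen. Qed.

Lemma free_cover_surj (T : lmodType R) : surjective (free_cover T).
Proof. by move=> x; exists (free_gen R x); apply: free_cover_gen. Qed.

Lemma Tor1_zero (T M : lmodType R) :
  zero_module (Tor1 T M) <->
  injective (tensor_map M (sub_incl (ker_lin (free_cover T)))).
Proof.
pose i : {linear syzygy T -> free_module T} :=
  sub_incl (ker_lin (free_cover T)).
have d1E x : tensor_map M (free_diff T) x =
    tensor_map M i (tensor_map M (free_cover (syzygy T)) x).
  exact: tensor_map_comp.
have csurj := @tensor_map_surj _ _ _ M _ (@free_cover_surj (syzygy T)).
split=> [/homology_zero h|inj]; last first.
  apply/homology_zero => x /=; rewrite d1E => /(inj_eq0 inj) cx0.
  have [u ux] := tensor_right_exact (@free_cover_surj (syzygy T)) cx0.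
  have [v vu] := @tensor_map_surj _ _ _ M _ (@free_cover_surj (syzygy (syzygy
    T))) u.
  exists v; rewrite -ux -vu; exact: tensor_map_comp.
apply: linear_inj => y iy0; have [x xy] := csurj y.
have [|u ux] := h x; first by rewrite /= d1E xy.
rewrite -xy -ux.
pose g : {linear _ -> tensor (syzygy T) M} :=
  tensor_map M (free_cover (syzygy T)) \o tensor_map M (free_diff (syzygy T)).
apply: (@tensor_ext _ _ _ _ g \0) => a m /=.
have cd0 : free_cover (syzygy T) (free_diff (syzygy T) a) = 0.
  exact/eqP/(valP (free_cover (syzygy (syzygy T)) a)).
by rewrite !tensor_map_tens cd0 tens0l.
Qed.

Lemma flat_phi_flat (M : lmodType R) : flat M -> phi_flat M.
Proof. by move=> Mflat T _; apply/Tor1_zero/Mflat/sub_incl_inj. Qed.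

Lemma phi_flat_retract (M N : lmodType R) (i : {linear M -> N})
    (j : {linear N -> M}) : cancel i j -> phi_flat N -> phi_flat M.
Proof.
move=> ij Nflat T /Nflat/Tor1_zero inj.
exact/Tor1_zero/(tensor_map_retract ij).
Qed.

Lemma phi_torsion_quot (B : lmodType R) (A : submodClosed B) :
    (forall b, exists2 s, s \notin nilradical R & s *: b \in A) ->
  phi_torsion (quot_mod A).
Proof.
move=> Ators x; rewrite -[x]quot_piK; have [s sN sA] := Ators (repr x).
exists (principal_ideal s); split=> [|_ /asboolP[r <-]].
  by exists s => //; apply: cyclic_self.
by rewrite -linearZ; apply/quot_pi_eq0; rewrite /= -scalerA rpredZ.
Qed.

(* B is the pushout of A and the free cover of B/A along the syzygy of B/A, and
   tensoring preserves pushouts. *)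
Lemma phi_flat_inj (M B : lmodType R) (A : submodClosed B) :
    phi_flat M -> phi_torsion (quot_mod A) ->
  injective (tensor_map M (sub_incl A)).
Proof.
move=> Mflat /Mflat/Tor1_zero; set T := quot_mod A; set K := ker_lin _ => inj.
pose q : {linear free_module T -> B} := free_lift (fun t : T => repr t).
have qgen t : q (free_gen R t) = repr t by rewrite /q /= free_lift_gen.
have piq x : quot_pi A (q x) = free_cover T x.
  pose pq : {linear _ -> _} := quot_pi A \o q.
  apply: (@free_ext _ _ _ pq (free_cover T)) => t.
  by rewrite /= qgen free_lift_gen quot_piK.
have qK (k : submodule K) : q (sub_incl K k) \in A.
  by apply/quot_pi_eq0; rewrite piq; apply/eqP/(valP k).
pose qA := @lift_sub _ _ _ A (q \o sub_incl K : {linear _ -> _}) qK.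
pose P : lmodType R := (tensor (submodule A) M * tensor (free_module T) M)%type.
pose d (k : tensor (submodule K) M) : P :=
  (tensor_map M qA k, - tensor_map M (sub_incl K) k).
have dlin : linear d.
  by move=> r x y; rewrite /d !linearP.
pose D := im_lin (lin_of dlin).
have repA (b : B) : b - repr (quot_pi A b) \in A.
  by apply/quot_pi_eq0; rewrite linearB /= quot_piK subrr.
pose h (b : B) (m : M) : quot_mod D := quot_pi D
  (tens (sub_elt (repA b)) m, tens (free_gen R (quot_pi A b)) m).
have hE b a x m : sub_incl A a + q x = b -> free_cover T x = quot_pi A b ->
    h b m = quot_pi D (tens a m, tens x m).
  move=> axb xb; apply/eqP; rewrite -subr_eq0 -linearB; apply/eqP/quot_pi_eq0.
  have kK : x - free_gen R (quot_pi A b) \in K.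
    by apply/eqP; rewrite linearB xb /= free_lift_gen subrr.
  have e1 : qA (sub_elt kK) = sub_elt (repA b) - a.
    apply: val_inj; rewrite -[LHS]/(q (x - free_gen R (quot_pi A b))).
    rewrite linearB qgen -[RHS]/(b - repr (quot_pi A b) - sub_incl A a).
    by rewrite addrAC (_ : b - _ = q x) // -axb addrC addKr.
  have e2 : - sub_incl K (sub_elt kK) = free_gen R (quot_pi A b) - x.
    exact: opprB.
  apply/asboolP; exists (tens (sub_elt kK) m).
  by rewrite /= /d !tensor_map_tens -tensNl e1 e2 !tensBl.
have hself b m : h b m = quot_pi D
    (tens (sub_elt (repA b)) m, tens (free_gen R (quot_pi A b)) m) by [].
have hbil : bilinear_map h.
  split=> [m|b] r x y; last first.
    rewrite !hself -linearP; congr (quot_pi D _).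
    by rewrite !tensDr !tensZr.
  rewrite [h x m]hself [h y m]hself -linearP.
  rewrite (hE _ (r *: sub_elt (repA x) + sub_elt (repA y))
     (r *: free_gen R (quot_pi A x) + free_gen R (quot_pi A y))).
  - by rewrite !tensDl !tensZl.
  - rewrite !linearP !qgen /=.
    by rewrite addrACA -scalerDr !subrK.
  - by rewrite !linearP /= !free_lift_gen.
have [L LE] := tensor_lift hbil.
apply: linear_inj => t ft0.
have LfE : L (tensor_map M (sub_incl A) t) = quot_pi D (t, 0).
  pose g1 : {linear _ -> _} := L \o tensor_map M (sub_incl A).
  have g2L : linear (fun t => quot_pi D (t, 0)).
    move=> r x y; rewrite -linearP; congr (quot_pi D (_, _)).
    by rewrite /= scaler0 addr0.
  apply: (@tensor_ext _ _ _ _ g1 (lin_of g2L)) => a m.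
  rewrite /= tensor_map_tens LE (hE _ a 0).
  - by rewrite tens0l.
  - by rewrite linear0 addr0.
  - by rewrite linear0; apply/esym/quot_pi_eq0/(valP a).
move: LfE; rewrite ft0 linear0 => /esym/quot_pi_eq0/asboolP[k [kt /eqP]].
rewrite oppr_eq0 => /eqP/(inj_eq0 inj) k0.
by rewrite -kt k0 linear0.
Qed.

Lemma tens_eq0_ann (M B : lmodType R) (b : B) (x : M) :
    injective (tensor_map M (sub_incl (im_lin (act b)))) -> tens b x = 0 ->
  x \in submod_span (fun y => exists c m, c *: b = 0 /\ y = c *: m).
Proof.
set A := im_lin _ => inj bx0; set D := submod_span _.
have /choice[r rE] (a : submodule A) : exists r : R, r *: b = sub_incl A a.
  by have /asboolP[r rb] := valP a; exists r.
pose h a m := quot_pi D (r a *: m).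
have hE a r' m : r' *: b = sub_incl A a -> h a m = quot_pi D (r' *: m).
  move=> r'E; apply/eqP; rewrite -subr_eq0 -linearB; apply/eqP/quot_pi_eq0.
  apply: submod_spanP; exists (r a - r'), m.
  by rewrite !scalerBl rE r'E subrr.
have hbil : bilinear_map h.
  split=> [m|a] c y z; last first.
    by rewrite /h scalerDr linearD scalerA mulrC -scalerA linearZ.
  rewrite (hE _ (c * r y + r z)); last first.
    by rewrite scalerDl -scalerA !rE linearP.
  by rewrite scalerDl -scalerA linearP.
have [L LE] := tensor_lift hbil.
have := LE (sub_elt (cyclic_self b)) x.
rewrite (hE _ 1) ?scale1r // (_ : tens _ x = 0) ?linear0 => [/esym|].
  by move/quot_pi_eq0.
by apply: (inj_eq0 inj); rewrite /= tensor_map_tens.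
Qed.

Definition tens_restr (C M : lmodType R) (M0 : submodClosed M) :
    {linear {malg R[(C * M)%type]} -> tensor C (submodule M0)} :=
  free_lift (fun p : C * M => tens p.1 (insubd (0 : submodule M0) p.2)).

Lemma tens_restr_gen (C M : lmodType R) (M0 : submodClosed M) c m :
  tens_restr C M0 (free_gen R (c, m)) = tens c (insubd (0 : submodule M0) m).
Proof. by rewrite /tens_restr /= free_lift_gen. Qed.

(* A relation in C (x) M only involves finitely many elements of M, so it
   already holds in C (x) M0 for every submodule M0 containing these. *)
Lemma tensor_rel_finite (C M : lmodType R) z :
    z \in submod_span (@tensor_rel R C M) ->
  exists X : seq M, forall M0 : submodClosed M,
    {subset X <= M0} -> tens_restr C M0 z = 0.
Proof.
move: z; apply: span_ind => [|a x y [X XP] [Y YP]|z].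
- by exists [::] => M0 _; rewrite linear0.
- exists (X ++ Y) => M0 XY; rewrite linearP XP ?YP ?scaler0 ?addr0 // => m mX.
    by apply: XY; rewrite mem_cat mX orbT.
  by apply: XY; rewrite mem_cat mX.
case=> [c c' m|c m m'|r c m|r c m].
- exists [::] => M0 _; rewrite !linearB !tens_restr_gen tensDl.
  by rewrite -addrA -opprD subrr.
- exists [:: m; m'] => M0 mM0; rewrite !linearB !tens_restr_gen.
  have mm : m \in M0 by rewrite mM0 ?inE ?eqxx.
  have mm' : m' \in M0 by rewrite mM0 ?inE ?eqxx ?orbT.
  rewrite (_ : insubd _ (m + m') = insubd 0 m + insubd 0 m'); last first.
    by apply: sub_incl_inj; rewrite linearD !sub_inclK // rpredD.
  by rewrite tensDr -addrA -opprD subrr.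
- exists [::] => M0 _.
  rewrite linearB [tens_restr _ _ (r *: _)]linearZ !tens_restr_gen.
  by rewrite tensZl subrr.
- exists [:: m] => M0 mM0; have mm : m \in M0 by rewrite mM0 ?inE ?eqxx.
  rewrite linearB [tens_restr _ _ (r *: _)]linearZ !tens_restr_gen.
  rewrite (_ : insubd _ (r *: m) = r *: insubd 0 m) ?tensZr ?subrr //.
  by apply: sub_incl_inj; rewrite linearZ !sub_inclK // rpredZ.
Qed.

Lemma directed_flat (M : lmodType R) :
    (forall X : seq M, exists2 M0 : submodClosed M,
       {subset X <= M0} & flat (submodule M0)) ->
  flat M.
Proof.
move=> dir A B f finj; apply: linear_inj => t ft0.
pose F : {linear {malg R[(A * M)%type]} -> {malg R[(B * M)%type]}} :=
  free_lift (fun p : A * M => free_gen R (f p.1, p.2)).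
have Fgen a m : F (free_gen R (a, m)) = free_gen R (f a, m).
  by rewrite /F /= free_lift_gen.
pose z := repr t.
have zt : quot_pi (submod_span (@tensor_rel R A M)) z = t by apply: quot_piK.
have /quot_pi_eq0/tensor_rel_finite[X XP] :
    quot_pi (submod_span (@tensor_rel R B M)) (F z) = 0.
  rewrite -[RHS]ft0 -zt.
  pose g1 : {linear _ -> _} := quot_pi (submod_span (@tensor_rel R B M)) \o F.
  pose g2 : {linear _ -> _} :=
    tensor_map M f \o quot_pi (submod_span (@tensor_rel R A M)).
  apply: (@free_ext _ _ _ g1 g2) => -[a m] /=.
  by rewrite Fgen [RHS]tensor_map_tens.
have [M0 XM0 M0flat] := dir (X ++ [seq k.2 | k <- msupp z]).
have t00 : tens_restr A M0 z = 0.
  apply: (inj_eq0 (M0flat _ _ _ finj)); rewrite -[RHS](XP M0); last first.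
    by move=> m mX; apply: XM0; rewrite mem_cat mX.
  pose g1 : {linear _ -> _} := tensor_map (submodule M0) f \o tens_restr A M0.
  pose g2 : {linear _ -> _} := tens_restr B M0 \o F.
  apply: (@free_ext _ _ _ g1 g2) => -[a m] /=.
  by rewrite Fgen !tens_restr_gen tensor_map_tens.
have [J JE] := tensor_mapr A (sub_incl M0).
pose g : {linear _ -> _} := J \o tens_restr A M0.
suff gz : g z = quot_pi (submod_span (@tensor_rel R A M)) z.
  by rewrite -zt -gz /= t00 linear0.
rewrite [z]malgE (linear_sum g) (linear_sum (quot_pi _)).
rewrite big_seq [RHS]big_seq; apply: eq_bigr => -[a m] mz.
rewrite !linearZ /=; congr (_ *: _); rewrite tens_restr_gen JE sub_inclK //.
apply: XM0; rewrite mem_cat; apply/orP; right.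
exact: (map_f (fun k : A * M => k.2) mz).
Qed.

End Flatness.

(** * Dual bases *)

Section DualBasis.
Variable R : comNzRingType.

Definition dual_basis (K : lmodType R) : Prop :=
  exists d : seq (K * {linear K -> R^o}),
    forall x, x = \sum_(q <- d) (q.2 x : R) *: q.1.

Lemma fg_cover (M : lmodType R) : finitely_generated M ->
  exists n (f : {linear 'rV[R]_n -> M}), surjective f.
Proof.
move=> [s sM].
have fL : linear (fun v : 'rV[R]_(size s) => \sum_i v 0 i *: nth 0 s i).
  move=> a u v; rewrite scaler_sumr -big_split; apply: eq_bigr => i _.
  by rewrite !mxE scalerDl scalerA.
exists (size s), (lin_of fL) => x; move: x (sM x).
apply: span_ind => [|a x y [u ux] [v vy]|x xs].
- by exists 0; rewrite linear0.
- by exists (a *: u + v); rewrite linearP ux vy.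
have xi : (index x s < size s)%N by rewrite index_mem.
exists (delta_mx 0 (Ordinal xi)); rewrite /= (bigD1 (Ordinal xi)) //=.
rewrite mxE !eqxx scale1r nth_index // big1 ?addr0 // => i ix.
by rewrite mxE (negPf ix) andbF scale0r.
Qed.

Lemma rV_dual_basis (M : lmodType R) n (f : {linear 'rV[R]_n -> M})
    (g : {linear M -> 'rV[R]_n}) : cancel g f -> dual_basis M.
Proof.
move=> gf.
have hL i : linear (fun x => g x 0 i : R^o).
  by move=> a x y; rewrite linearP !mxE.
exists [seq (f (delta_mx 0 i), lin_of (hL i)) | i <- enum 'I_n] => x.
rewrite big_map big_enum -{1}[x]gf [g x]row_sum_delta linear_sum.
by apply: eq_bigr => i _; rewrite linearZ.
Qed.

Lemma projective_dual_basis (M : lmodType R) :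
  finitely_generated M -> projective M -> dual_basis M.
Proof.
move=> /fg_cover[n [f fsurj]] Mproj.
have [h hE] := Mproj _ _ f idfun fsurj.
exact: (rV_dual_basis hE).
Qed.

Lemma dual_basis_projective (M : lmodType R) : dual_basis M -> projective M.
Proof.
move=> [d dE] A B g f /choice[r rK].
have hL : linear (fun x => \sum_(q <- d) (q.2 x : R) *: r (f q.1)).
  move=> a x y; rewrite scaler_sumr -big_split; apply: eq_bigr => q _.
  by rewrite linearP scalerDl scalerA.
exists (lin_of hL) => x; rewrite /= linear_sum [x in RHS]dE linear_sum.
by apply: eq_bigr => q _; rewrite !linearZ /= rK.
Qed.

Lemma tensor_eval (A M : lmodType R) (h : {linear M -> R^o}) :
  exists g : {linear tensor A M ->
    A}, forall a m, g (tens a m) = (h m : R) *: a.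
Proof.
apply: tensor_lift; split=> [m|a] c x y.
  by rewrite scalerDr !scalerA mulrC.
by rewrite linearP scalerDl scalerA.
Qed.

Lemma tensor_evall (A M : lmodType R) (h : {linear A -> R^o}) :
  exists g : {linear tensor A M ->
    M}, forall a m, g (tens a m) = (h a : R) *: m.
Proof.
apply: tensor_lift; split=> [m|a] c x y.
  by rewrite linearP scalerDl scalerA.
by rewrite scalerDr !scalerA mulrC.
Qed.

Lemma tensor_evall_eq0 (A B C M : lmodType R) (f : {linear A -> B})
    (f' : {linear B -> C}) (c : {linear C -> R^o})
    (g : {linear tensor A M -> M}) t :
    (forall a m, g (tens a m) = (c (f' (f a)) : R) *: m) ->
  tensor_map M f' (tensor_map M f t) = 0 -> g t = 0.
Proof.
move=> gE ft0; have [ev evE] := tensor_evall M c.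
rewrite -(linear0 ev) -ft0.
pose g' : {linear _ -> _} := ev \o tensor_map M f' \o tensor_map M f.
apply: (@tensor_ext _ _ _ _ g g') => a m /=.
by rewrite gE !tensor_map_tens evE.
Qed.

Lemma dual_basis_flat (M : lmodType R) : dual_basis M -> flat M.
Proof.
move=> [d dE] A B f finj; apply: linear_inj => t ft0.
have [eA eAE] := choice (@tensor_eval A M).
have [eB eBE] := choice (@tensor_eval B M).
have gL : linear (fun t => \sum_(q <- d) tens (eA q.2 t) q.1).
  move=> a x y; rewrite scaler_sumr -big_split; apply: eq_bigr => q _.
  by rewrite linearP tensDl tensZl.
have -> : t = \sum_(q <- d) tens (eA q.2 t) q.1.
  apply: (@tensor_ext _ _ _ _ idfun (lin_of gL)) => a m.
  rewrite -[LHS]/(tensr M a m) {1}[m]dE linear_sum.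
  apply: eq_bigr => q _.
  by rewrite linearZ /= eAE tensZl.
rewrite big1 // => q _; rewrite (_ : eA _ _ = 0) ?tens0l //.
apply: (inj_eq0 finj); rewrite -(linear0 (eB q.2)) -ft0.
pose g1 : {linear _ -> _} := f \o eA q.2.
pose g2 : {linear _ -> _} := eB q.2 \o tensor_map M f.
apply: (@tensor_ext _ _ _ _ g1 g2) => a m /=.
by rewrite eAE tensor_map_tens eBE linearZ.
Qed.

Section Extension.
Variables (K N : lmodType R) (p : {linear K -> N}).
Hypotheses (psurj : surjective p) (Nd : dual_basis N).

Lemma dual_basis_split :
  exists pi : {linear K -> submodule (ker_lin p)},
    cancel (sub_incl (ker_lin p)) pi /\
    (dual_basis (submodule (ker_lin p)) -> dual_basis K).
Proof.
have [d dE] := Nd; have [r rK] := choice psurj.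
have sL : linear (fun x => \sum_(q <- d) (q.2 x : R) *: r q.1).
  move=> a x y; rewrite scaler_sumr -big_split; apply: eq_bigr => q _.
  by rewrite linearP scalerDl scalerA.
pose s := lin_of sL; have sK : cancel s p.
  move=> x; rewrite linear_sum [RHS]dE; apply: eq_bigr => q _.
  by rewrite linearZ /= rK.
have piK k : k - s (p k) \in ker_lin p.
  by apply/eqP; rewrite linearB sK subrr.
have piL : linear (fun k => k - s (p k)).
  by move=> a x y; rewrite !linearP addrACA -scalerDr.
pose pi := @lift_sub _ _ _ (ker_lin p) (lin_of piL) piK.
exists pi; split=> [k|[d' d'E]].
  apply: sub_incl_inj; rewrite -[LHS]/(sub_incl _ k - s (p (sub_incl _ k))).
  by rewrite (eqP (valP k) : p (sub_incl _ k) = 0) linear0 subr0.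
pose ext (P : lmodType R) (f : {linear K -> P}) (g : P -> K)
    (q : P * {linear P -> R^o}) : K * {linear K -> R^o} :=
  let h : {linear K -> R^o} := q.2 \o f in (g q.1, h).
exists (map (ext _ p r) d ++ map (ext _ pi (sub_incl (ker_lin p))) d').
move=> x; rewrite big_cat !big_map /= -[LHS](subrK (s (p x))) addrC.
congr (_ + _); rewrite -[LHS]/(sub_incl _ (pi x)) [pi x]d'E linear_sum.
by apply: eq_bigr => q _; rewrite linearZ.
Qed.

Lemma fg_ker : finitely_generated K ->
  finitely_generated (submodule (ker_lin p)).
Proof.
have [pi [piK _]] := dual_basis_split.
by apply: (@fg_image _ _ _ pi) => k; exists (sub_incl _ k).
Qed.

End Extension.

End DualBasis.

(** * Nonnil ideals with dual bases *)

Section NonnilRegular.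
Variable R : comNzRingType.

Lemma nil_fix (M : lmodType R) c (y : M) :
  c \in nilradical R -> y = c *: y -> y = 0.
Proof.
move=> /asboolP[n cn0] yc; rewrite -[0](scale0r y) -cn0.
by elim: n {cn0} => [|n IH]; rewrite ?scale1r // exprSr -scalerA -yc.
Qed.

Hypothesis hR : phi_ring R.

Lemma nonnilM s t : s \notin nilradical R -> t \notin nilradical R ->
  s * t \notin nilradical R.
Proof.
have [[_ pr] _] := hR; move=> sN tN.
by apply/negP => /pr/orP[]; apply/negP.
Qed.

Lemma nonnil1 : 1 \notin nilradical R.
Proof. by have [[[_ ? _] _] _] := hR. Qed.

Lemma nonnil_ann s c : s \notin nilradical R -> s * c = 0 -> c \in nilradical R.
Proof.
have [[[nil0 _ _] pr] _] := hR; move=> sN sc0.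
by have /pr : s * c \in nilradical R; rewrite ?sc0 // (negPf sN).
Qed.

Lemma nonnil_fix s c (M : lmodType R) (y : M) :
  s \notin nilradical R -> s * c = s -> (1 - c) *: y = y -> y = 0.
Proof.
move=> sN sc cy; apply: (@nil_fix _ (1 - c)); last by rewrite cy.
by apply: (nonnil_ann sN); rewrite mulrBr mulr1 sc subrr.
Qed.

Lemma phi_torsion_nonnil (T : lmodType R) (x : T) : phi_torsion T ->
  exists2 s, s \notin nilradical R & s *: x = 0.
Proof. by move=> /(_ x)[I [[s sI sN] Ix]]; exists s => //; apply: Ix. Qed.

Lemma phi_torsion_seq (T : lmodType R) (X : seq T) : phi_torsion T ->
  exists2 s, s \notin nilradical R & forall x, x \in X -> s *: x = 0.
Proof.
move=> Ttors; elim: X => [|x X [s sN sX]]; first by exists 1; rewrite ?nonnil1.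
have [t tN tx] := phi_torsion_nonnil x Ttors.
exists (t * s); first exact: nonnilM.
move=> y; rewrite inE => /orP[/eqP->|/sX sy];
  last by rewrite -scalerA sy scaler0.
by rewrite mulrC -scalerA tx scaler0.
Qed.

Lemma principal_fg (s : R) : finitely_generated (submodule (principal_ideal s)).
Proof.
pose y : submodule (principal_ideal s) := sub_elt (cyclic_self (s : R^o)).
exists [:: y] => x; have /asboolP[r rx] := valP x.
rewrite (_ : x = (r : R) *: y); first by apply/rpredZ/submod_spanP/mem_head.
by apply: sub_incl_inj; rewrite linearZ -[LHS]rx.
Qed.

Lemma phi_flat_ann (M : lmodType R) s (x : M) :
    phi_flat M -> s \notin nilradical R -> s *: x = 0 ->
  x \in submod_span (fun y => exists c m, c * s = 0 /\ y = c *: m).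
Proof.
move=> Mflat sN sx0; apply: (@tens_eq0_ann _ _ R^o s).
  apply: phi_flat_inj Mflat _; apply: phi_torsion_quot => r.
  exists s => //; rewrite -[s *: r]/(s * r) mulrC.
  exact: (act_im (s : R^o) r).
rewrite -[X in tens X x](_ : s *: (1 : R^o) = s);
  last by rewrite -[LHS]/(s * 1) mulr1.
by rewrite tensZl -tensZr sx0 tens0r.
Qed.

Definition nonnil_dual_basis : Prop := forall I : submodClosed R^o,
  finitely_generated (submodule I) -> nonnil_ideal I ->
    dual_basis (submodule I).

Hypothesis nnd : nonnil_dual_basis.

Lemma nonnil_dual_basis_regular s j : s \notin nilradical R -> s * j = 0 ->
  j = 0.
Proof.
move=> sN sj0; have sI : s \in principal_ideal s by apply: cyclic_self.
have [d dE] := nnd (principal_fg s) (ex_intro2 _ _ s sI sN).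
pose y := sub_elt sI.
have /choice[r rE] (q : submodule (principal_ideal s)) : exists r, r * s = val
  q.
  by have /asboolP[r rE] := valP q; exists r.
pose e := \sum_(q <- d) q.2 y * r q.1.
have se : s * e = s.
  transitivity (sub_incl (principal_ideal s) y); last by [].
  rewrite [y in RHS]dE linear_sum mulr_sumr; apply: eq_bigr => q _.
  by rewrite linearZ mulrCA [s * _]mulrC rE.
apply: (@nonnil_fix s e R^o) => //.
rewrite -[LHS]/((1 - e) * j) mulrBl mul1r mulr_suml big1 ?subr0 // => q _.
have jy : j * q.2 y = 0.
  transitivity (q.2 (j *: y)); first by rewrite linearZ.
  rewrite (_ : j *: y = 0) ?linear0 //.
  by apply: sub_incl_inj; rewrite linearZ linear0 -[LHS]/(j * s) mulrC.
by rewrite mulrAC [_ * j]mulrC jy mul0r.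
Qed.

Lemma coord_dual_basis n (K : lmodType R) (p : 'I_n -> {linear K -> R^o})
    (k : 'I_n -> K) s : s \notin nilradical R -> finitely_generated K ->
    (forall x, (forall i, p i x = 0) -> x = 0) ->
    (forall i j, p i (k j) = if i == j then s else 0) ->
  dual_basis K.
Proof.
move=> sN; elim: n K p k => [|n IH] K p k Kfg pinj pk.
  by exists [::] => x; rewrite big_nil; apply: pinj => -[].
pose I : submodClosed R^o := im_lin (p ord0).
have PI x : p ord0 x \in I by apply/asboolP; exists x.
pose P := lift_sub PI.
have Psurj : surjective P.
  by move=> [y yI]; have /asboolP[x xy] := yI; exists x; apply: val_inj.
have Id : dual_basis (submodule I).
  apply: nnd; first exact: fg_image Psurj Kfg.
  by exists s => //; have := PI (k ord0); rewrite pk eqxx.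
have [_ [_]] := dual_basis_split Psurj Id; apply.
have Pk i : k (lift ord0 i) \in ker_lin P.
  by apply/eqP/val_inj; rewrite /= pk.
pose p' i : {linear submodule (ker_lin P) -> R^o} :=
  p (lift ord0 i) \o sub_incl (ker_lin P).
apply: (IH _ p' (fun i => sub_elt (Pk i))); first exact: fg_ker.
  move=> x p'x; apply: sub_incl_inj; rewrite linear0; apply: pinj => i.
  have [j ->|->] := unliftP ord0 i; first exact: p'x.
  exact: (congr1 val (eqP (valP x))).
by move=> i j; rewrite /p' -[LHS]/(p (lift ord0 i) (k (lift ord0 j))) pk.
Qed.

Lemma coord_expand n (K : lmodType R) (p : 'I_n -> {linear K -> R^o})
    (k : 'I_n -> K) s (h : {linear K -> R^o}) x :
    (forall x, (forall i, p i x = 0) -> x = 0) ->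
    (forall i j, p i (k j) = if i == j then s else 0) ->
  s * h x = \sum_i h (k i) * p i x.
Proof.
move=> pinj pk; have sx : s *: x = \sum_i (p i x : R) *: k i.
  apply/eqP; rewrite -subr_eq0; apply/eqP/pinj => i.
  rewrite linearB linearZ linear_sum (bigD1 i) //= linearZ /= pk eqxx.
  rewrite big1 => [|j /negPf ji]; last first.
    by rewrite linearZ /= pk eq_sym ji [LHS]mulr0.
  by rewrite addr0 [X in X - _]mulrC subrr.
transitivity (h (s *: x)); first by rewrite linearZ.
rewrite sx linear_sum; apply: eq_bigr => i _.
by rewrite linearZ [LHS]mulrC.
Qed.

Lemma coord_tensor_eq0 n (K M : lmodType R) (p : 'I_n -> {linear K -> R^o})
    (k : 'I_n -> K) s (t : tensor K M) :
    dual_basis K -> (forall x, (forall i, p i x = 0) -> x = 0) ->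
    (forall i j, p i (k j) = if i == j then s else 0) ->
    (forall m : M, s *: m = 0 -> m = 0) ->
    (forall i (g : {linear tensor K M -> M}),
       (forall a m, g (tens a m) = (p i a : R) *: m) -> g t = 0) ->
  t = 0.
Proof.
move=> [d dE] pinj pk Mtf pt.
have [ev evE] := choice (@tensor_evall R K M).
have tE : t = \sum_(q <- d) tens q.1 (ev q.2 t).
  have gL : linear (fun t => \sum_(q <- d) tens q.1 (ev q.2 t)).
    move=> a x y; rewrite scaler_sumr -big_split; apply: eq_bigr => q _.
    by rewrite linearP tensDr tensZr.
  apply: (@tensor_ext _ _ _ _ idfun (lin_of gL)) => a m.
  rewrite -[LHS]/(tensl _ m a) {1}[a]dE linear_sum; apply: eq_bigr => q _.
  by rewrite linearZ /= evE tensZr.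
have sev h : s *: ev h t = 0.
  transitivity (\sum_i (h (k i) : R) *: ev (p i) t); last first.
    by rewrite big1 // => i _; rewrite (pt i (ev (p i))) ?scaler0.
  have gL : linear (fun t => \sum_i (h (k i) : R) *: ev (p i) t).
    move=> a x y; rewrite scaler_sumr -big_split; apply: eq_bigr => i _.
    by rewrite linearP scalerDr !scalerA mulrC.
  pose g : {linear _ -> _} := smul M s \o ev h.
  apply: (@tensor_ext _ _ _ _ g (lin_of gL)) => x m.
  rewrite -[LHS]/(s *: ev h (tens x m)) -[RHS]/(\sum_i _) evE scalerA.
  rewrite (coord_expand h x pinj pk) scaler_suml; apply: eq_bigr => i _.
  by rewrite evE scalerA mulrC.
by rewrite tE big1 // => q _; rewrite (Mtf _ (sev q.2)) tens0r.
Qed.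

Lemma torsion_free_phi_flat (M : lmodType R) :
    (forall s (m : M), s \notin nilradical R -> s *: m = 0 -> m = 0) ->
  phi_flat M.
Proof.
move=> Mtf T Ttors; apply/Tor1_zero; set K := ker_lin _.
apply: linear_inj => t it0; have [l tl] := tensor_sum t.
pose D : seq T := undup (flatten [seq msupp (sub_incl K q.1) : seq T | q <- l]).
have lD q x : q \in l -> x \notin D -> mcoeff x (sub_incl K q.1) = 0.
  move=> ql xD; apply: mcoeff_outdom; apply: contra xD => xq.
  by rewrite mem_undup; apply/flattenP;
    exists (enum_fset (msupp (sub_incl K q.1))) => //;
    apply/mapP; exists q.
have [s sN sD] := phi_torsion_seq D Ttors.
have sK x : x \in D -> s *: free_gen R x \in K.
  by move=> xD; apply/eqP; rewrite linearZ /= free_lift_gen sD.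
pose n := size D; pose e (i : 'I_n) : T := tnth (in_tuple D) i.
have eD i : e i \in D by apply: mem_tnth.
pose k0 (i : 'I_n) : submodule K := sub_elt (sK _ (eD i)).
pose Y : seq (submodule K) := map fst l ++ [seq k0 i | i <- enum 'I_n].
pose K0 := submod_span (fun x => x \in Y).
have YK0 x : x \in Y -> x \in K0 by move=> xY; apply: submod_spanP.
have K0D x y : x \in K0 -> y \notin D -> mcoeff y (sub_incl K x) = 0.
  move=> xK0 yD; move: x xK0; apply: span_ind => [|a x z xy zy|x].
  - by rewrite linear0 mcoeff0.
  - by rewrite linearP mcoeffD mcoeffZ xy zy mulr0 addr0.
  rewrite mem_cat => /orP[/mapP[q ql ->]|/mapP[i _ ->]]; first exact: lD.
  rewrite /= mcoeffZ mcoeffU; case: eqP => [ey|]; last by rewrite mulr0.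
  by rewrite -ey eD in yD.
pose p i : {linear submodule K0 -> R^o} :=
  coef R (e i) \o sub_incl K \o sub_incl K0.
have kK0 i : k0 i \in K0.
  by apply: YK0; rewrite mem_cat map_f ?mem_enum ?orbT.
pose k i : submodule K0 := sub_elt (kK0 i).
have pinj x : (forall i, p i x = 0) -> x = 0.
  move=> px; apply: sub_incl_inj; apply: sub_incl_inj; rewrite !linear0.
  apply/malgP => y; rewrite mcoeff0.
  have [yD|yD] := boolP (y \in D); last by apply: K0D => //; apply: (valP x).
  have /tnthP[i ->] : y \in in_tuple D by [].
  exact: px.
have pk i j : p i (k j) = if i == j then s else 0.
  rewrite -[LHS]/(coef R (e i) (s *: free_gen R (e j))) linearZ coef_gen.
  rewrite (inj_eq (_ : injective e)); last exact/tuple_uniqP/undup_uniq.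
  by rewrite eq_sym; case: eqP => _; [apply: mulr1|apply: mulr0].
pose t0 : tensor (submodule K0) M :=
  \sum_(q <- l) tens (insubd (0 : submodule K0) q.1) q.2.
have t0t : tensor_map M (sub_incl K0) t0 = t.
  by rewrite tl; apply: tensor_sum_sub => q ql; rewrite YK0 // mem_cat map_f.
suff t00 : t0 = 0 by rewrite -t0t t00 linear0.
have Kd := coord_dual_basis sN (fg_span Y) pinj pk.
apply: (coord_tensor_eq0 Kd pinj pk) => [m|i g gE]; first exact: Mtf.
by apply: (tensor_evall_eq0 gE); rewrite t0t.
Qed.

End NonnilRegular.

(** * Dual bases from flatness *)

Section FlatIdeals.
Variable R : comNzRingType.

Lemma principal_span_ann (B : lmodType R) (b : B) (a : R)
    (x : submodule (principal_ideal a)) :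
    x \in submod_span (fun y => exists c m, c *: b = 0 /\ y = c *: m) ->
  exists2 c, c *: b = 0 & val x = c * a.
Proof.
move: x; apply: span_ind => [|r x y [c cb xc] [d db yd]|_ [c [m [cb ->]]]].
- by exists 0; rewrite ?scale0r // mul0r.
- exists (r * c + d).
    by rewrite scalerDl -scalerA cb db scaler0 addr0.
  rewrite -[LHS]/(r * val x + val y) xc yd; by rewrite mulrDl mulrA.
- have /asboolP[r rm] := valP m; exists (r * c).
    by rewrite -scalerA cb scaler0.
  by rewrite -[LHS]/(c * val m) -rm -[act _ _]/(r * a) mulrCA mulrA.
Qed.

Lemma flat_principal_regular (hR : phi_ring R) s j :
    s \notin nilradical R -> flat (submodule (principal_ideal s)) ->
      s * j = 0 ->
  j = 0.
Proof.
move=> sN sflat sj0; pose y : submodule (principal_ideal s) :=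
  sub_elt (cyclic_self (s : R^o)).
have ty : tens (j : R^o) y = 0.
  rewrite (_ : (j : R^o) = j *: (1 : R^o));
    last by rewrite -[RHS]/(j * 1) mulr1.
  rewrite tensZl -tensZr (_ : j *: y = 0) ?tens0r //.
  by apply: sub_incl_inj; rewrite linearZ linear0 -[LHS]/(j * s) mulrC.
have [|c cj sc] := @principal_span_ann R^o j s y.
  by apply: (@tens_eq0_ann _ _ R^o) ty; apply/sflat/sub_incl_inj.
apply: (@nonnil_fix _ hR s c R^o j sN); first by rewrite mulrC.
by rewrite scalerBl scale1r cj subr0.
Qed.

Lemma phi_flat_principal_regular (hR : phi_ring R) s j :
    s \notin nilradical R -> phi_flat (submodule (principal_ideal j)) ->
  s * j = 0 -> j = 0.
Proof.
move=> sN jflat sj0; pose y : submodule (principal_ideal j) :=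
  sub_elt (cyclic_self (j : R^o)).
have sy : s *: y = 0 by apply: sub_incl_inj; rewrite linearZ linear0.
have [c cs jc] := @principal_span_ann R^o s j y (phi_flat_ann jflat sN sy).
apply: (@nil_fix _ R^o c) => //; apply: (nonnil_ann hR sN).
by rewrite mulrC.
Qed.

Lemma inj_dual_basis (I : submodClosed R^o) (s : R) :
    s \in I -> s \notin nilradical R -> (forall j : R, s * j = 0 -> j = 0) ->
    finitely_generated (submodule I) ->
    (forall (B : lmodType R) (A : submodClosed B), phi_torsion (quot_mod A) ->
       injective (tensor_map (submodule I) (sub_incl A))) ->
  dual_basis (submodule I).
Proof.
move=> sI sN sreg /fg_cover[n [f fsurj]] Iinj.
pose a j : R := val (f (delta_mx 0 j)).
pose D := im_lin (smul 'rV[R]_n s).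
pose b := quot_pi D (\row_j a j).
have sB (z : quot_mod D) : s *: z = 0.
  rewrite -[z]quot_piK -linearZ; apply/quot_pi_eq0/asboolP.
  by exists (repr z).
pose y : submodule I := sub_elt sI.
have ty : tens b y = 0.
  rewrite /b [\row_j _]row_sum_delta linear_sum.
  rewrite -[LHS]/(tensl _ y _) linear_sum big1 // => j _.
  rewrite linearZ -[tensl _ y _]/(tens _ y) tensZl -tensZr mxE.
  rewrite (_ : a j *: y = s *: f (delta_mx 0 j)) ?tensZr -?tensZl ?sB ?tens0l
    //.
  by apply: sub_incl_inj; rewrite !linearZ; apply: mulrC.
have hc c : c *: b = 0 ->
    exists h : {linear submodule I -> R^o}, forall x, s * h x = c * val x.
  rewrite -linearZ => /quot_pi_eq0/asboolP[w wc].
  have /choice[h hE] (x : submodule I) : exists r, s * r = c * val x.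
    have [v <-] := fsurj x; exists (\sum_j v 0 j * w 0 j).
    rewrite [v in RHS]row_sum_delta linear_sum -[X in _ = _ * X]/(sub_incl I _).
    rewrite linear_sum !mulr_sumr; apply: eq_bigr => j _.
    have swc : s * w 0 j = c * a j.
      by have /matrixP/(_ 0 j) := wc; rewrite !mxE.
    by rewrite !linearZ mulrCA swc mulrCA.
  have hL : linear (h : submodule I -> R^o).
    move=> r x z; apply/eqP; rewrite -subr_eq0; apply/eqP/sreg.
    rewrite mulrBr mulrDr -[r *: (h x : R^o)]/(r * h x) mulrCA !hE.
    rewrite -[val (_ + _)]/(r * val x + val z) mulrDr [c * (r * _)]mulrCA.
    by rewrite subrr.
  by exists (lin_of hL).
have : y \in submod_span (fun y => exists c m, c *: b = 0 /\ y = c *: m).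
  apply: tens_eq0_ann ty; apply/Iinj/phi_torsion_quot => z.
  by exists s; rewrite // sB rpred0.
have key : forall z, z \in submod_span
    (fun y : submodule I => exists c m, c *: b = 0 /\ y = c *: m) ->
  exists d : seq (submodule I * {linear submodule I -> R^o}), forall x,
    (val x : R) *: z = s *: \sum_(q <- d) (q.2 x : R) *: q.1.
  apply: span_ind => [|r z w [d dz] [e ew]|_ [c [m [cb ->]]]].
  - by exists [::] => x; rewrite big_nil !scaler0.
  - exists ([seq (r *: q.1, q.2) | q <- d] ++ e) => x.
    rewrite big_cat big_map /= scalerDr [RHS]scalerDr -ew; congr (_ + _).
    rewrite scalerA mulrC -scalerA dz !scaler_sumr; apply: eq_bigr => q _.
    by rewrite !scalerA; congr (_ *: _); rewrite [RHS]mulrC !mulrA mulrAC.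
  have [h hE] := hc c cb; exists [:: (m, h)] => x.
  by rewrite big_seq1 /= !scalerA hE mulrC.
move=> /key[d dE]; exists d => x; apply: sub_incl_inj; apply/eqP.
rewrite -subr_eq0; apply/eqP/sreg; rewrite mulrBr.
have := congr1 (sub_incl I) (dE x); rewrite !linearZ => e.
by apply/eqP; rewrite subr_eq0; apply/eqP; apply: etrans e; apply: mulrC.
Qed.

End FlatIdeals.

(** * Extensions *)

Section Ext.
Variable R : comNzRingType.

Definition extends (M P : lmodType R) (S : submodClosed P) : Prop :=
  forall f : {linear submodule S -> M}, exists g : {linear P -> M},
    forall x, g (sub_incl S x) = f x.

Lemma factor_surj (P N M : lmodType R) (p : {linear P -> N})
    (X : {linear P -> M}) : surjective p -> (forall y, p y = 0 -> X y = 0) ->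
  exists f : {linear N -> M}, forall y, f (p y) = X y.
Proof.
move=> /choice[r rK] Xker.
have XE y z : p y = p z -> X y = X z.
  move=> yz; apply/eqP; rewrite -subr_eq0 -linearB; apply/eqP/Xker.
  by rewrite linearB yz subrr.
have fL : linear (fun k => X (r k)).
  by move=> a k l; rewrite -linearP; apply: XE; rewrite linearP !rK.
by exists (lin_of fL) => y; apply: XE; rewrite rK.
Qed.

Definition hom_of (P M : lmodType R) (f : {linear P -> M}) : Defs.hom P M :=
  exist _ (f : P -> M) (asboolT (linearP f)).

Definition lin_of_hom (P M : lmodType R) (f : Defs.hom P M) : {linear P -> M} :=
  lin_of (asboolW (valP f)).

Lemma free_diff_gen (T : lmodType R) (k : syzygy T) :
  free_diff T (free_gen R k) = sub_incl (ker_lin (free_cover T)) k.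
Proof. by rewrite -[LHS]/(sub_incl _ (free_cover _ (free_gen R k)))
  free_cover_gen. Qed.

Lemma Ext1_zero (T M : lmodType R) :
  zero_module (Ext1 T M) <-> extends M (ker_lin (free_cover T)).
Proof.
split=> [/homology_zero h f|h].
  pose x : Defs.hom (free_module (syzygy T)) M :=
    hom_of (f \o free_cover (syzygy T) : {linear _ -> _}).
  have [|u ux] := h x.
    apply: val_inj; apply/funext => z.
    have cd0 : free_cover (syzygy T) (free_diff (syzygy T) z) = 0.
      exact/eqP/(valP (free_cover (syzygy (syzygy T)) z)).
    by rewrite -[LHS]/(f (free_cover (syzygy T) (free_diff (syzygy T) z))) cd0
      linear0.
  exists (lin_of_hom u) => k.
  have /(congr1 (fun g : Defs.hom _ _ => val g (free_gen R k))) := ux.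
  rewrite -[RHS]/(f (free_cover (syzygy T) (free_gen R k))).
  rewrite -[LHS]/(val u (free_diff T (free_gen R k))).
  by rewrite free_diff_gen free_cover_gen.
apply/homology_zero => x x0.
have xker z : free_cover (syzygy T) z = 0 -> val x z = 0.
  move=> /eqP z0; pose k : syzygy (syzygy T) := sub_elt (z0 : z \in ker_lin _).
  have := congr1 (fun g : Defs.hom _ _ => val g (free_gen R k)) x0.
  by rewrite -[LHS]/(val x (free_diff (syzygy T) (free_gen R k)))
    free_diff_gen.
have [f fE] := factor_surj (@free_cover_surj _ (syzygy T)) (X :=
  lin_of_hom x) xker.
have [g gE] := h f; exists (hom_of g).
apply: val_inj; apply/funext => y.
rewrite -[LHS]/(g (sub_incl _ (free_cover (syzygy T) y))) gE.
exact: fE.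
Qed.

Lemma extends_presentation (T M P P' : lmodType R) (p : {linear P -> T})
    (p' : {linear P' -> T}) (u : {linear P -> P'}) (v : {linear P' -> P}) :
    (forall x, p' (u x) = p x) -> (forall y, p (v y) = p' y) ->
  extends M (ker_lin p) -> extends M (ker_lin p').
Proof.
move=> pu pv pext f.
have uK (x : submodule (ker_lin p)) : u (sub_incl _ x) \in ker_lin p'.
  by apply/eqP; rewrite pu; apply/eqP/(valP x).
pose U := @lift_sub _ _ _ (ker_lin p') (u \o sub_incl (ker_lin p) : {linear _
  -> _}) uK.
have [g gE] := pext (f \o U : {linear _ -> _}).
have dK w : w - u (v w) \in ker_lin p' by apply/eqP;
  rewrite linearB pu pv subrr.
have dL : linear (fun w => w - u (v w)).
  by move=> a x y; rewrite !linearP addrACA -scalerDr.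
pose D := @lift_sub _ _ _ (ker_lin p') (lin_of dL) dK.
have GL : linear (fun w => g (v w) + f (D w)).
  by move=> a x y; rewrite !linearP addrACA -scalerDr.
exists (lin_of GL) => x /=.
have vK : v (sub_incl _ x) \in ker_lin p.
  by apply/eqP; rewrite pv; apply/eqP/(valP x).
rewrite -[v _]/(sub_incl _ (sub_elt vK)) gE /= -linearD; congr (f _).
by apply: sub_incl_inj; rewrite linearD; apply: subrKC.
Qed.

Lemma free_lift_section (T P : lmodType R) (p : {linear P -> T}) :
  surjective p -> exists v : {linear free_module T -> P},
    forall y, p (v y) = free_cover T y.
Proof.
move=> /choice[r rK]; pose v : {linear free_module T -> P} := free_lift r.
exists v => y; pose pv : {linear _ -> _} := p \o v.
apply: (@free_ext _ _ _ pv (free_cover T)) => t.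
by rewrite /= !free_lift_gen rK.
Qed.

Lemma rV_lift (T P : lmodType R) n (f : {linear 'rV[R]_n -> T})
    (p : {linear P -> T}) :
  surjective p -> exists u : {linear 'rV[R]_n -> P}, forall x, p (u x) = f x.
Proof.
move=> /choice[r rK].
have uL : linear (fun v : 'rV[R]_n => \sum_i v 0 i *: r (f (delta_mx 0 i))).
  move=> a x y; rewrite scaler_sumr -big_split; apply: eq_bigr => i _.
  by rewrite !mxE scalerDl scalerA.
exists (lin_of uL) => x; rewrite [x in RHS]row_sum_delta !linear_sum.
by apply: eq_bigr => i _; rewrite !linearZ /= rK.
Qed.

Section NonnilDualBasis.
Hypotheses (hR : phi_ring R) (nnd : nonnil_dual_basis R).

Lemma divisible_nonnil_FP_injective (M : lmodType R) : divisible M ->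
  nonnil_FP_injective M.
Proof.
move=> Mdiv T [n [f [fsurj Kfg]]] Ttors; apply/Ext1_zero.
have [v vE] := free_lift_section fsurj.
have [u uE] := rV_lift f (@free_cover_surj _ T).
apply: (extends_presentation uE vE) => g.
have [s sN sT] := phi_torsion_seq hR [seq f (delta_mx 0 i) | i <- enum 'I_n]
  Ttors.
have sreg : s \in regular R by apply/regularP => y;
  apply: nonnil_dual_basis_regular.
have [D DE] := choice (Mdiv s sreg).
have cL (i : 'I_n) : linear (fun x : 'rV[R]_n => x 0 i : R^o).
  by move=> a x y; rewrite !mxE.
pose p i : {linear submodule (ker_lin f) -> R^o} :=
  lin_of (cL i) \o sub_incl (ker_lin f).
have kK i : s *: delta_mx 0 i \in ker_lin f.
  by apply/eqP; rewrite linearZ; apply/sT/map_f; rewrite mem_enum.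
pose k i := sub_elt (kK i).
have pinj x : (forall i, p i x = 0) -> x = 0.
  move=> px; apply: sub_incl_inj; apply/rowP => i; rewrite [RHS]mxE.
  exact: px.
have pk i j : p i (k j) = if i == j then s else 0.
  rewrite /= !mxE eqxx /=; case: eqP => _; [exact: mulr1|exact: mulr0].
have [d dE] := coord_dual_basis nnd sN Kfg pinj pk.
have GL : linear (fun x : 'rV[R]_n => \sum_i x 0 i *:
    \sum_(q <- d) (q.2 (k i) : R) *: D (g q.1)).
  move=> a x y; rewrite scaler_sumr -big_split; apply: eq_bigr => i _.
  by rewrite !mxE scalerDl scalerA.
exists (lin_of GL) => x; rewrite [in RHS](dE x) linear_sum /=.
transitivity (\sum_(q <- d) (s * q.2 x) *: D (g q.1)); last first.
  by apply: eq_bigr => q _; rewrite linearZ /= -[in RHS](DE (g q.1)) scalerA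
    mulrC.
transitivity (\sum_(q <- d) \sum_i ((q.2 (k i) : R) * p i x) *: D (g q.1)).
  rewrite exchange_big; apply: eq_bigr => i _; rewrite scaler_sumr.
  by apply: eq_bigr => q _; rewrite scalerA mulrC.
apply: eq_bigr => q _.
by rewrite (coord_expand q.2 x pinj pk) scaler_suml.
Qed.

End NonnilDualBasis.
End Ext.

(** * Enough injectives *)

Section DivisibleGroups.
Local Open Scope classical_set_scope.

Definition zdivisible (D : lmodType int) : Prop :=
  forall (n : nat) (d : D), (0 < n)%N -> exists e : D, (n%:Z : int) *: e = d.

Section Extend.
Variables (A B D : lmodType int) (g : {linear A -> B}) (f : {linear A -> D}).
Hypotheses (Ddiv : zdivisible D) (ginj : injective g).

Definition partial_extension (G : set (B * D)) : Prop :=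
  [/\ forall (n : int) p q, G p -> G q -> G (n *: p + q),
      forall a, G (g a, f a) & forall d, G (0, d) -> d = 0].

Lemma partial_extension_max :
  exists2 G, partial_extension G &
    forall G', partial_extension G' -> G `<=` G' -> G' `<=` G.
Proof.
pose Q (G : set (B * D)) := G = set0 \/ partial_extension G.
have [F FQ Ftot|G [GQ Gmax]] := @Zorn_bigcup _ Q.
  have [->|/set0P[p [X0 FX0 X0p]]] := eqVneq (\bigcup_(X in F) X) set0.
    by left.
  have FP X q : F X -> X q -> partial_extension X.
    by move=> FX Xq; case: (FQ X FX) => // X0E; move: Xq; rewrite X0E.
  right; split=> [n q q' [X FX Xq] [Y FY Yq]|a|d [X FX Xd]].
  - have [XY|YX] := Ftot X Y FX FY.
      by exists Y => //; have [+ _ _] := FP _ _ FY Yq; apply => //; apply: XY.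
    by exists X => //; have [+ _ _] := FP _ _ FX Xq; apply => //; apply: YX.
  - by exists X0 => //; have [_ + _] := FP _ _ FX0 X0p; apply.
  - by have [_ _ +] := FP _ _ FX Xd; apply.
have GP : partial_extension G.
  case: GQ => // G0; exfalso.
  pose G1 : set (B * D) := [set p | exists a, p = (g a, f a)].
  apply: (Gmax G1).
    rewrite G0; split=> // /(_ (g 0, f 0)); apply.
    by exists 0.
  right; split=> [n _ _ [a ->] [b ->]|a|d [a [a0 ->]]].
  - by exists (n *: a + b); rewrite !linearP.
  - by exists a.
  - by rewrite (inj_eq0 ginj (esym a0)) linear0.
exists G => // G' G'P GG'; apply: contrapT => G'G.
by apply: (Gmax G'); [split | right].
Qed.

Lemma divisible_extend : exists h : {linear B -> D}, forall a, h (g a) = f a.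
Proof.
have [G GP Gmax] := partial_extension_max.
have [Glin Ggraph G0] := GP.
have G00 : G (0, 0) by have := Ggraph 0; rewrite !linear0.
have GZ n p : G p -> G (n *: p).
  by move=> Gp; rewrite -[_ *: p]addr0; apply: Glin.
have Gfun b d d' : G (b, d) -> G (b, d') -> d = d'.
  move=> Gd Gd'; apply/eqP; rewrite -subr_eq0; apply/eqP/G0.
  have := Glin (-1) _ _ Gd' Gd; rewrite scaleN1r.
  by rewrite -[X in G X]/(- b + b, - d' + d) addNr addrC.
have Gdom b : exists d, G (b, d).
  apply: contrapT => bdom.
  have [e eE] : exists e : D, forall (n : int) d, G (n *: b, d) -> d = n *: e.
    pose P n := (0 < n)%N && `[< exists d, G (n%:Z *: b, d) >].
    have [Pex|Pno] := pselect (exists n, P n); last first.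
      exists 0 => n d Gd; rewrite scaler0; apply: G0.
      have nP m d' : (0 < m)%N -> ~ G (m%:Z *: b, d').
        by move=> m0 Gm; apply: Pno; exists m; rewrite /P m0; apply/asboolP;
          exists d'.
      case: n Gd => [[|n]|n] Gd;
        [by rewrite scale0r in Gd|by case: (nP _ _ _ Gd)|].
      case: (nP n.+1 (- d)) => //.
      by have := GZ (-1) _ Gd; rewrite scaleN1r -[X in G X]/(- _, - _) -scaleNr.
    case: (ex_minnP Pex) => n /andP[n0 /asboolP[d0 Gd0]] nmin.
    have [e nE] := Ddiv d0 n0; exists e => m d Gm.
    have r0 : (m %% n)%Z = 0.
      have [r rE] : exists r : nat, (m %% n)%Z = r%:Z.
        by exists `|(m %% n)%Z|%N; rewrite gez0_abs // modz_ge0 // -lt0n.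
      rewrite rE; case: (posnP r) => [->//|r_gt0].
      have /nmin : P r.
        rewrite /P r_gt0; apply/asboolP; exists (- (m %/ n)%Z *: d0 + d).
        have -> : r%:Z *: b = - (m %/ n)%Z *: (n%:Z *: b) + m *: b.
          rewrite scalerA -scalerDl; congr (_ *: _).
          by rewrite -rE {3}(divz_eq m n) mulNr addKr.
        exact: (Glin (- (m %/ n)%Z) _ _ Gd0 Gm).
      by rewrite leqNgt -ltz_nat -rE ltz_pmod.
    apply: Gfun Gm _; rewrite (divz_eq m n) r0 addr0 -!scalerA nE.
    exact: (GZ _ _ Gd0).
  pose G' : set (B * D) :=
    [set p | exists2 q, G q & exists n : int, p = q + n *: (b, e)].
  apply: bdom; exists e; apply: (Gmax G').
  - split=> [n _ _ [p Gp [m ->]] [q Gq [l ->]]|a|d [[x y] Gxy [n /eqP]]].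
    + exists (n *: p + q); first exact: Glin.
      exists (n * m + l).
      by rewrite scalerDr addrACA scalerA -scalerDl.
    + by exists (g a, f a) => //; exists 0; rewrite scale0r addr0.
    + rewrite xpair_eqE => /andP[/eqP /= xE /eqP ->].
      have xnb : x = - n *: b by apply/eqP; rewrite scaleNr -addr_eq0 -xE.
      rewrite /= in Gxy *; rewrite xnb in Gxy.
      by rewrite (eE _ _ Gxy) scaleNr addNr.
  - by move=> p Gp; exists p => //; exists 0; rewrite scale0r addr0.
  - by exists (0, 0) => //; exists 1; rewrite scale1r add0r.
have [h hE] := choice Gdom.
have hL : linear h.
  by move=> n x y; exact: (Gfun (n *: x + y)) (hE _) (Glin n _ _ (hE x) (hE y)).
by exists (lin_of hL) => a; apply: Gfun (hE _) (Ggraph a).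
Qed.

End Extend.
Lemma zlinear (V : zmodType) (W : lmodType int) (f : V -> W) :
  {morph f : x y / x + y} -> linear (f : zmodule V -> W).
Proof.
move=> fD; have f0 : f 0 = 0 by apply: (addIr (f 0)); rewrite -fD !add0r.
have fN x : f (- x) = - f x.
  by apply: (addIr (f x)); rewrite -fD !addNr.
have fM n x : f (x *+ n) = f x *+ n.
  by elim: n => [|n IH]; rewrite ?mulr0n // !mulrS fD IH.
move=> n x y; rewrite fD; congr (_ + _).
rewrite -[n in RHS]intz scaler_int.
case: n => n; first exact: fM.
by rewrite -[LHS]/(f (- (x *+ n.+1))) fN fM.
Qed.

(* M = Z^(M) / ker embeds into Q^(M) / ker. *)
Lemma divisible_embedding (M : lmodType int) : exists (D : lmodType int)
  (i : {linear M -> D}), zdivisible D /\ injective i.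
Proof.
pose Q : lmodType int := zmodule {malg rat[M]}.
pose gen (m : M) : Q := free_gen rat m.
pose emb : {linear {malg int[M]} -> Q} := free_lift gen.
have embE k z : mcoeff k (emb z : {malg rat[M]}) = (mcoeff k z)%:~R.
  have c1D : {morph (fun x : {malg rat[M]} => mcoeff k x) : x y / x + y}.
    by move=> x y; rewrite mcoeffD.
  pose c1 : {linear {malg int[M]} -> zmodule rat} :=
    lin_of (@zlinear _ (zmodule rat) _ c1D) \o emb.
  have c2L : linear (fun z : {malg int[M]} => (mcoeff k z)%:~R : zmodule rat).
    move=> n x y; rewrite mcoeffD mcoeffZ rmorphD rmorphM; congr (_ + _).
    exact: mulrzl.
  apply: (@free_ext _ _ _ c1 (lin_of c2L)) => m.
  by rewrite /= free_lift_gen !mcoeffU; case: eqP.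
have embg m : emb (free_gen int m) = gen m by apply: free_lift_gen.
pose Kf := emb \o sub_incl (ker_lin (free_cover M)) : {linear _ -> Q}.
pose K := im_lin Kf.
have iL : linear (fun m => quot_pi K (gen m)).
  move=> n x y; rewrite -linearP; apply/eqP; rewrite -subr_eq0 -linearB.
  apply/eqP/quot_pi_eq0/asboolP.
  have zK : free_gen int (n *: x + y) - (n *: free_gen int x + free_gen int y)
      \in ker_lin (free_cover M).
    by apply/eqP; rewrite linearB linearP !free_cover_gen subrr.
  exists (sub_elt zK).
  rewrite -[LHS]/(emb (_ - _)) linearB linearP.
  by rewrite !embg.
exists (quot_mod K : lmodType int), (lin_of iL); split=> [n d n0|].
  pose x : {malg rat[M]} := repr d.
  exists (quot_pi K (n%:R^-1 *: x : {malg rat[M]})).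
  rewrite -linearZ -[RHS]quot_piK; congr (quot_pi K _).
  rewrite -[LHS]/((n%:R^-1 *: x) *+ n) -scaler_nat scalerA mulfV ?scale1r //.
  by rewrite Num.Theory.pnatr_eq0 -lt0n.
apply: linear_inj => m /quot_pi_eq0/asboolP[z zE].
have : sub_incl (ker_lin (free_cover M)) z = free_gen int m.
  apply/malgP => k; apply: (@intr_inj rat); rewrite -!embE.
  by rewrite embg -zE.
move=> zm; rewrite -[m]free_cover_gen -zm.
exact: (eqP (valP z)).
Qed.

End DivisibleGroups.

Section Coinduced.
Variables (R : comNzRingType) (D : lmodType int).

Definition coinduced : Type := Defs.hom (zmodule R) D.
HB.instance Definition _ := GRing.Zmodule.on coinduced.

Definition coind_app (f : coinduced) : {linear zmodule R -> D} :=
  lin_of_hom (f : Defs.hom (zmodule R) D).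

Definition coind_of (f : {linear zmodule R -> D}) : coinduced := hom_of f.

Lemma coind_ofE (f : {linear zmodule R ->
  D}) x : coind_app (coind_of f) x = f x.
Proof. by []. Qed.

Lemma coind_ext (f g : coinduced) :
  (forall x, coind_app f x = coind_app g x) -> f = g.
Proof. by move=> fg; apply: val_inj; apply/funext. Qed.

Lemma coind_appD f g x : coind_app (f + g) x = coind_app f x + coind_app g x.
Proof. by []. Qed.

Lemma coind_scale_linear (r : R) (f : coinduced) :
  linear (fun y : zmodule R => coind_app f (r * (y : R))).
Proof.
move=> n x y.
by rewrite -linearP; congr (coind_app f _); rewrite mulrDr [r * _]mulrzAr.
Qed.

Definition coind_scale (r : R) (f : coinduced) : coinduced :=
  coind_of (lin_of (coind_scale_linear r f)).

Lemma coind_scaleE r f (x : R) :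
  coind_app (coind_scale r f) x = coind_app f (r * x).
Proof. by []. Qed.

Lemma coind_scaleA a b f : coind_scale a (coind_scale b f) = coind_scale (a *
  b) f.
Proof. by apply: coind_ext => x; rewrite !coind_scaleE mulrCA mulrA. Qed.

Lemma coind_scale1 : left_id 1 coind_scale.
Proof. by move=> f; apply: coind_ext => x; rewrite coind_scaleE mul1r. Qed.

Lemma coind_scaleDr : right_distributive coind_scale +%R.
Proof. by move=> a f g; apply: coind_ext. Qed.

Lemma coind_scaleDl f : {morph coind_scale^~ f : a b / a + b}.
Proof.
move=> a b; apply: coind_ext => x.
by rewrite coind_appD !coind_scaleE mulrDl linearD.
Qed.

HB.instance Definition _ := GRing.Zmodule_isLmodule.Build R coinduced
  coind_scaleA coind_scale1 coind_scaleDr coind_scaleDl.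

Lemma coinduced_linear (M : lmodType R) (h : {linear zmodule M -> D}) :
  exists g : {linear M -> coinduced},
    forall m (y : R), coind_app (g m) y = h (y *: m).
Proof.
have mD (m : M) : {morph (fun y : R => y *: m) : x y / x + y}.
  by move=> x y; rewrite scalerDl.
pose hm m : {linear zmodule R -> D} :=
  h \o lin_of (@zlinear _ (zmodule M) _ (mD m)).
have gL : linear (fun m => coind_of (hm m) : coinduced).
  move=> a x y; apply: coind_ext => z.
  rewrite coind_appD coind_scaleE !coind_ofE /= scalerDr scalerA mulrC.
  by rewrite linearD.
by exists (lin_of gL).
Qed.

Lemma coinduced_injective : zdivisible D ->
  injective_module (coinduced : lmodType R).
Proof.
move=> Ddiv A B g f ginj.
have gD : {morph g : x y / x + y} by move=> x y; rewrite linearD.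
have fD : {morph (fun a => coind_app (f a) (1 : R)) : x y / x + y}.
  by move=> x y; rewrite linearD.
have [h hE] := @divisible_extend _ _ _ (lin_of (@zlinear _ (zmodule B) _ gD))
  (lin_of (zlinear fD)) Ddiv ginj.
have [G GE] := coinduced_linear h; exists G => a.
apply: coind_ext => y; rewrite GE -linearZ [LHS]hE /= linearZ.
by rewrite -[LHS]/(coind_app (f a) (y * 1)) mulr1.
Qed.

End Coinduced.

Lemma enough_injectives (R : comNzRingType) (M : lmodType R) :
  exists (E : lmodType R) (i : {linear M -> E}),
    injective_module E /\ injective i.
Proof.
have [D [i [Ddiv iinj]]] := divisible_embedding (zmodule M).
have [g gE] := coinduced_linear i.
exists (coinduced R D : lmodType R), g; split; first exact: coinduced_injective.
by move=> x y xy; apply: iinj; rewrite -[x]scale1r -[y]scale1r -!gE xy.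
Qed.

(** * h-divisible modules and flat nonnil ideals *)

Section NonnilIdeals.
Variable R : comNzRingType.

Lemma h_divisible_divisible (M : lmodType R) : h_divisible M -> divisible M.
Proof.
move=> [E [f [Einj fsurj]]] s /regularP sreg m; have [e <-] := fsurj m.
have sinj : injective (smul R^o s) by apply: linear_inj => x; apply: sreg.
have [h hE] := Einj _ _ (smul R^o s) (act e) sinj.
have h1 : h (s *: (1 : R^o)) = 1 *: e := hE (1 : R^o).
by exists (f (h (1 : R^o))); rewrite -!linearZ h1 scale1r.
Qed.

Lemma cyclic_quot_fp (I : submodClosed R^o) :
  finitely_generated (submodule I) -> finitely_presented (quot_mod I).
Proof.
move=> Ifg; have fL : linear (fun v : 'rV[R]_1 => quot_pi I (v 0 0)).
  by move=> a x y; rewrite -linearP !mxE.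
exists 1, (lin_of fL); split=> [x|].
  exists (\row_j repr x); rewrite /= mxE; exact: quot_piK.
have gL : linear (fun x : submodule I => \row_(j < 1) (sub_incl I x : R)).
  by move=> a x y; apply/rowP => j; rewrite !mxE linearP.
have gK x : lin_of gL x \in ker_lin (lin_of fL).
  by apply/eqP; rewrite /= mxE; apply/quot_pi_eq0/(valP x).
apply: (@fg_image _ _ _ (lift_sub gK)) Ifg => -[v vK].
have vI : v 0 0 \in I by apply/quot_pi_eq0/eqP.
exists (sub_elt vI); apply: val_inj; apply/rowP => j.
by rewrite /= mxE ord1.
Qed.

Lemma nonnil_ideal_quot (I : submodClosed R^o) :
  nonnil_ideal I -> phi_torsion (quot_mod I).
Proof.
move=> [s sI sN]; apply: phi_torsion_quot => r; exists s => //.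
rewrite -[s *: r]/(s * r) mulrC; exact: (rpredZ (r : R) sI).
Qed.

Lemma Ext1_cyclic (I : submodClosed R^o) (M : lmodType R)
    (f : {linear submodule I -> M}) : zero_module (Ext1 (quot_mod I) M) ->
  exists m : M, forall x, f x = (val x : R) *: m.
Proof.
move=> /Ext1_zero Mext.
have piS : surjective (quot_pi I) by move=> x; exists (repr x); apply: quot_piK.
have [v vE] := free_lift_section piS.
have uE x : free_cover (quot_mod I) (act (free_gen R (quot_pi I 1)) x) =
  quot_pi I x.
  rewrite /= linearZ free_cover_gen -linearZ; congr (quot_pi I _).
  exact: mulr1.
have kI (x : submodule (ker_lin (quot_pi I))) : sub_incl _ x \in I.
  by apply/quot_pi_eq0/eqP/(valP x).
have [g gE] := extends_presentation vE uE Mext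
  (f \o @lift_sub _ _ _ I (sub_incl _) kI : {linear _ -> _}).
exists (g (1 : R^o)) => x.
have xK : val x \in ker_lin (quot_pi I) by apply/eqP/quot_pi_eq0/(valP x).
transitivity (g (val x)).
  by rewrite (gE (sub_elt xK)) /=; congr (f _); apply: val_inj.
by rewrite -linearZ; congr (g _); rewrite -[RHS]/(val x * 1) mulr1.
Qed.

Lemma h_divisible_dual_basis :
    (forall M : lmodType R, h_divisible M -> nonnil_FP_injective M) ->
  nonnil_dual_basis R.
Proof.
move=> Minj I Ifg Inn; have [n [f fsurj]] := fg_cover Ifg.
have [E [i [Einj iinj]]] := enough_injectives ('rV[R]_n : lmodType R).
pose N := im_lin (i \o sub_incl (ker_lin f) : {linear _ -> _}).
have Mh : h_divisible (quot_mod N).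
  exists E, (quot_pi N); split=> // x; exists (repr x); exact: quot_piK.
have fker y : f y = 0 -> quot_pi N (i y) = 0.
  move=> /eqP fy; apply/quot_pi_eq0/asboolP.
  by exists (sub_elt (fy : y \in ker_lin f)).
have [th thE] := @factor_surj _ _ _ _ f (quot_pi N \o i : {linear _ ->
  _}) fsurj fker.
have [m mE] := Ext1_cyclic th
  (Minj _ Mh _ (cyclic_quot_fp Ifg) (nonnil_ideal_quot Inn)).
pose e := repr m.
have /choice[g gE] (x : submodule I) : exists w,
    i w = (val x : R) *: e /\ f w = x.
  have [v vx] := fsurj x.
  have xm : quot_pi N (i v) = (val x : R) *: m by rewrite -mE -vx thE.
  have /quot_pi_eq0/asboolP[k kE] : quot_pi N (i v - (val x : R) *: e) = 0.
    by rewrite linearB linearZ /= quot_piK xm subrr.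
  exists (v - sub_incl (ker_lin f) k); split.
    rewrite linearB (_ : i (sub_incl _ k) = i v - (val x : R) *: e) ?subKr //.
  by rewrite linearB vx (eqP (valP k) : f (sub_incl _ k) = 0) subr0.
have gL : linear g.
  move=> a x y; apply: iinj; rewrite linearP.
  rewrite (proj1 (gE x)) (proj1 (gE y)) (proj1 (gE (a *: x + y))).
  by rewrite scalerA -scalerDl.
by apply: (@rV_dual_basis _ _ _ f (lin_of gL)) => x; apply: (proj2 (gE x)).
Qed.

Lemma nonnil_ideal_flat (I : submodClosed R^o) :
  nonnil_dual_basis R -> nonnil_ideal I -> flat (submodule I).
Proof.
move=> nnd [s sI sN]; apply: directed_flat => X.
pose Y := sub_elt sI :: X.
pose M0 : submodClosed (submodule I) := submod_span (fun x => x \in Y).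
exists M0; first by move=> x xX; apply: submod_spanP; rewrite inE xX orbT.
pose p0 : {linear submodule M0 -> R^o} := sub_incl I \o sub_incl M0.
pose J : submodClosed R^o := im_lin p0.
have pJ x : p0 x \in J by apply/asboolP; exists x.
pose p := lift_sub pJ.
have psurj : surjective p.
  by move=> y; have /asboolP[x xy] := valP y; exists x; apply: val_inj.
have Jd : dual_basis (submodule J).
  apply: nnd; first exact: fg_image psurj (fg_span Y).
  have yM0 : sub_elt sI \in M0 by apply/submod_spanP/mem_head.
  by exists s => //; apply: (pJ (sub_elt yM0)).
apply: dual_basis_flat; have [_ [_]] := dual_basis_split psurj Jd; apply.
exists [::] => x; rewrite big_nil; apply: sub_incl_inj; rewrite linear0.
apply: sub_incl_inj; apply: sub_incl_inj; rewrite !linear0.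
exact: (congr1 val (eqP (valP x))).
Qed.

End NonnilIdeals.

(** * phi-invertible ideals *)

Lemma to_loc_eq (A : comPzRingType) (S : mulrClosed A) (x y : A) :
  to_loc S x = to_loc S y -> exists2 u, u \in S & u * x = u * y.
Proof.
move=> /eqP/loc_eqP[u uS /=]; rewrite !mulr1 => xy.
by exists u.
Qed.

Lemma to_total_inj (A : comPzRingType) : injective (to_total A).
Proof.
move=> x y /to_loc_eq[u /regularP ureg xy]; apply/eqP.
by rewrite -subr_eq0; apply/eqP/ureg; rewrite mulrBr xy subrr.
Qed.

Lemma to_total_inv (A : comPzRingType) (s : A) : s \in regular A ->
  exists v : total_quotient A, to_total A s * v = 1.
Proof.
move=> sreg; exists (\pi_(loc (regular A))%qT (1, exist _ s sreg)).
rewrite -[LHS]pi_loc_mul; apply/eqP/loc_eqP.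
by exists 1; rewrite ?rpred1 //= !mul1r !mulr1.
Qed.

Section PhiPrufer.
Variables (R : comNzRingType) (hR : phi_ring R).

Lemma to_phiR_is_zmod_morphism : zmod_morphism (to_phiR hR).
Proof. by move=> x y; apply: val_inj; rewrite /= rmorphB. Qed.

Lemma to_phiR_is_monoid_morphism : monoid_morphism (to_phiR hR).
Proof. by split=> [|x y]; apply: val_inj; rewrite /= ?rmorph1 ?rmorphM. Qed.

HB.instance Definition _ :=
  GRing.isZmodMorphism.Build R (phiR hR) (to_phiR hR) to_phiR_is_zmod_morphism.
HB.instance Definition _ :=
  GRing.isMonoidMorphism.Build R (phiR hR) (to_phiR hR)
    to_phiR_is_monoid_morphism.

Lemma to_phiR_surj (y : phiR hR) : exists r, to_phiR hR r = y.
Proof. by have /asboolP[r ry] := valP y; exists r; apply: val_inj. Qed.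

Definition nonnil_regular := forall s r : R, s \notin nilradical R ->
  s * r = 0 -> r = 0.

Definition to_Q : {rmorphism R -> total_quotient (phiR hR)} :=
  to_total (phiR hR) \o to_phiR hR.

Section Regular.
Hypothesis reg : nonnil_regular.

Lemma to_phiR_inj : injective (to_phiR hR).
Proof.
move=> x y /(congr1 val)/to_loc_eq[u uN xy]; apply/eqP.
by rewrite -subr_eq0; apply/eqP/(reg uN); rewrite mulrBr xy subrr.
Qed.

Lemma to_Q_inj : injective to_Q.
Proof. by move=> x y /to_total_inj/to_phiR_inj. Qed.

Lemma to_phiR_regular s : s \notin nilradical R ->
  to_phiR hR s \in regular (phiR hR).
Proof.
move=> sN; apply/regularP => y; have [r <-] := to_phiR_surj y.
rewrite -rmorphM -(rmorph0 (to_phiR hR)) => /to_phiR_inj /(reg sN) ->.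
by [].
Qed.

Lemma phi_invertible_dual_basis (I : submodClosed R^o) :
  phi_invertible hR I -> dual_basis (submodule I).
Proof.
move=> [_ [_ inv]].
have [n [a [x [ax e1]]]] : ideal_mul_inv (phi_ideal (hR:=hR) I) 1.
  by apply/inv; exists 1; rewrite rmorph1.
have /choice[al alE] i : exists r : submodule I, to_phiR hR (val r) = a i.
  by have /asboolP[r rI ra] := proj1 (ax i); exists (sub_elt rI).
have /choice[h hE] (i : 'I_n) : exists h : {linear submodule I -> R^o},
    forall r, to_Q (h r) = to_Q (val r) * x i.
  have /choice[h hE] (r : submodule I) : exists t, to_Q t = to_Q (val r) * x i.
    have rJ : to_phiR hR (val r) \in phi_ideal (hR:=hR) I.
      by apply/asboolP; exists (val r) => //; apply: (valP r).
    have [b bE] := proj2 (ax i) _ rJ; have [t tb] := to_phiR_surj b.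
    by exists t; rewrite /to_Q /= tb -bE.
  have hL : linear (h : submodule I -> R^o).
    move=> c r t; apply: to_Q_inj.
    rewrite rmorphD -[c *: (h r : R^o)]/(c * h r) rmorphM !hE.
    rewrite -[val (_ + _)]/(c * val r + val t) rmorphD rmorphM.
    by rewrite mulrDl mulrA.
  by exists (lin_of hL).
exists [seq (al i, h i) | i <- enum 'I_n] => r.
rewrite big_map big_enum; apply/sub_incl_inj/to_Q_inj.
rewrite linear_sum rmorph_sum -[LHS]mulr1 e1 mulr_sumr.
apply: eq_bigr => i _; rewrite linearZ.
transitivity (to_Q (h i r * val (al i))); last by [].
by rewrite rmorphM hE -alE -mulrA [x i * _]mulrC.
Qed.

Lemma dual_basis_phi_invertible (I : submodClosed R^o) :
  nonnil_ideal I -> dual_basis (submodule I) -> phi_invertible hR I.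
Proof.
move=> Inn [d dE]; split=> //; have [s sI sN] := Inn.
have phiI r : r \in I -> to_phiR hR r \in phi_ideal (hR:=hR) I.
  by move=> rI; apply/asboolP; exists r.
split; first by exists (to_phiR hR s); [exact: phiI|exact: to_phiR_regular].
move=> y; split=> [[n [a [x [ax ->]]]]|[b ->]].
  have /choice[b bE] i : exists b, to_total (phiR hR) (a i) * x i = to_total _
    b.
    by have [aJ xinv] := ax i; apply: xinv.
  by exists (\sum_i b i); rewrite rmorph_sum; apply: eq_bigr => i _.
have [v vE] : exists v, to_Q s * v = 1.
  exact/to_total_inv/to_phiR_regular.
pose y0 : submodule I := sub_elt sI.
have [t tb] := to_phiR_surj b.
pose q0 := (0 : submodule I, \0 : {linear submodule I -> R^o}).
exists (size d), (fun i => to_phiR hR (t * val (nth q0 d i).1)),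
  (fun i => to_Q ((nth q0 d i).2 y0) * v).
split=> [i|].
  split; first by apply: phiI; apply: (rpredZ t (valP (nth q0 d i).1)).
  move=> a /asboolP[r rI <-]; exists (to_phiR hR ((nth q0 d i).2 (sub_elt rI))).
  set h := (nth q0 d i).2.
  have hsr : r * h y0 = s * h (sub_elt rI).
    transitivity (h ((r : R) *: y0)); first by rewrite linearZ.
    transitivity (h ((s : R) *: sub_elt rI)); last by rewrite linearZ.
    by congr (h _); apply: val_inj; apply: mulrC.
  rewrite mulrA -[to_total _ (to_phiR hR r)]/(to_Q r) -rmorphM hsr rmorphM.
  by rewrite mulrAC vE mul1r.
have sE : s = \sum_(i < size d) (nth q0 d i).2 y0 * val (nth q0 d i).1.
  have /(congr1 (sub_incl I)) := dE y0.
  by rewrite linear_sum (big_nth q0) big_mkord.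
rewrite -tb -[LHS]mulr1 -vE -[to_total _ _]/(to_Q t) [in to_Q s]sE.
rewrite rmorph_sum mulr_suml mulr_sumr; apply: eq_bigr => i _.
rewrite -[to_total _ _]/(to_Q (t * val (nth q0 d i).1)) !rmorphM.
by rewrite -!mulrA [to_Q (val _) * (_ * _)]mulrCA.
Qed.

End Regular.
End PhiPrufer.

(** * phi-flat envelopes *)

Section PhiFlat.
Variables (R : comNzRingType) (hR : phi_ring R).

Lemma nilradical_zero_divisor x : x \in nilradical R -> x \in zero_divisor R.
Proof.
move=> /asboolP[n0 xn0]; have xnil : exists n, x ^+ n == 0 by exists n0;
  apply/eqP.
case: (ex_minnP xnil) => -[|n] /eqP xn nmin.
  by move/eqP: xn; rewrite expr0 oner_eq0.
apply/asboolP; exists (x ^+ n); last by rewrite -exprS.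
by apply/negP => /nmin; rewrite ltnn.
Qed.

Lemma nonnil_regular_strong : nonnil_regular R <-> strong_phi_ring R.
Proof.
split=> [reg|[_ zn] s r sN sr0]; last first.
  have /regularP : s \in regular R by rewrite -zn in sN.
  exact.
split=> // x; apply/idP/idP; last exact: nilradical_zero_divisor.
move=> /asboolP[y y0 xy0]; apply: contraNT y0 => xN.
by rewrite (reg _ _ xN xy0).
Qed.

Lemma phi_flat_torsion_free (M : lmodType R) s (x : M) : nonnil_regular R ->
  phi_flat M -> s \notin nilradical R -> s *: x = 0 -> x = 0.
Proof.
move=> reg Mflat sN sx0; move: x {sx0} (phi_flat_ann Mflat sN sx0).
apply: span_ind => [|a x y -> ->|_ [c [m [cs0 ->]]]]; first by [].
  by rewrite scaler0 addr0.
by rewrite (reg s c sN) ?scale0r // mulrC.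
Qed.

Lemma regular_module_phi_flat : phi_flat (R^o : lmodType R).
Proof.
apply/flat_phi_flat/dual_basis_flat; exists [:: (1, idfun : {linear R^o ->
  R^o})].
by move=> x; rewrite big_seq1 /= -[RHS]/(x * 1) mulr1.
Qed.

Lemma surjective_preenvelope (M F : lmodType R) (f : {linear M -> F}) :
  phi_flat_preenvelope f -> surjective f -> phi_flat_envelope f.
Proof.
move=> fpre fsurj; split=> // g gf; exists id => y; have [x <-] := fsurj y;
  exact: gf.
Qed.

Lemma preenvelope_submodule_phi_flat :
    (forall M : lmodType R, exists (F : lmodType R) (f : {linear M -> F}),
       phi_flat_preenvelope f /\ surjective f) ->
  forall (M : lmodType R) (S : submodClosed M),
    phi_flat M -> phi_flat (submodule S).
Proof.
move=> pre M S Mflat; have [F [f [[Fflat ext] fsurj]]] := pre (submodule S).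
have [g gE] := ext _ (sub_incl S) Mflat.
have gS y : g y \in S.
  by have [x <-] := fsurj y; rewrite -[g _]gE; apply: (valP x).
apply: (@phi_flat_retract _ _ _ f (lift_sub gS)) Fflat => x.
by apply: val_inj; rewrite /= -[g _]gE.
Qed.

Definition torsion (M : lmodType R) of phi_ring R : {pred M} :=
  fun x => `[< exists2 s, s \notin nilradical R & s *: x = 0 >].

Lemma torsion_submod_closed (M : lmodType R) : submod_closed (@torsion M hR).
Proof.
split=> [|a x y /asboolP[s sN sx] /asboolP[t tN ty]]; apply/asboolP.
  by exists 1; rewrite ?(nonnil1 hR) ?scaler0.
exists (s * t); first exact: nonnilM.
rewrite scalerDr -[(s * t) *: y]scalerA ty scaler0 addr0 scalerA.
by rewrite -mulrA mulrC -scalerA sx scaler0.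
Qed.
HB.instance Definition _ (M : lmodType R) :=
  GRing.isSubmodClosed.Build R M (@torsion M hR) (torsion_submod_closed M).

Hypothesis nnd : nonnil_dual_basis R.

Lemma nonnil_dual_basis_nonnil_regular : nonnil_regular R.
Proof. by move=> s r; apply: nonnil_dual_basis_regular. Qed.

Lemma submodule_phi_flat (M : lmodType R) (S : submodClosed M) :
  phi_flat M -> phi_flat (submodule S).
Proof.
move=> Mflat; apply: torsion_free_phi_flat => // s x sN sx0.
apply: sub_incl_inj; rewrite linear0.
apply: (phi_flat_torsion_free nonnil_dual_basis_nonnil_regular Mflat sN).
by rewrite -linearZ sx0 linear0.
Qed.

Lemma phi_flat_preenvelope_surj (M : lmodType R) :
  exists (F : lmodType R) (f : {linear M -> F}),
    phi_flat_preenvelope f /\ surjective f.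
Proof.
pose S : submodClosed M := @torsion M hR.
exists (quot_mod S), (quot_pi S); split; last first.
  by move=> x; exists (repr x); apply: quot_piK.
split=> [|F' f' F'flat].
  apply: torsion_free_phi_flat => // s m sN.
  rewrite -[m]quot_piK -linearZ => /quot_pi_eq0/asboolP[t tN tsm].
  apply/quot_pi_eq0/asboolP; exists (t * s); first exact: nonnilM.
  by rewrite -scalerA.
have [g gE] : exists g : {linear quot_mod S -> F'},
    forall x, g (quot_pi S x) = f' x.
  apply: quot_lift => x /asboolP[s sN sx0].
  apply: (phi_flat_torsion_free nonnil_dual_basis_nonnil_regular F'flat sN).
  by rewrite -linearZ sx0 linear0.
by exists g => x; rewrite /= gE.
Qed.

End PhiFlat.

Lemma nonnil_dual_basisP (R : comNzRingType) (hR : phi_ring R) :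
  nonnil_dual_basis R <-> phi_Prufer hR /\ strong_phi_ring R.
Proof.
split=> [nnd|[Pr /(nonnil_regular_strong hR) reg] I Ifg Inn].
  have reg := nonnil_dual_basis_nonnil_regular hR nnd; split;
    last exact/nonnil_regular_strong.
  by move=> I Ifg Inn; apply: dual_basis_phi_invertible => //; apply: nnd.
by apply: phi_invertible_dual_basis; [|apply: Pr].
Qed.

Lemma flat_nonnil_dual_basis (R : comNzRingType) (hR : phi_ring R) :
    (forall I : submodClosed R^o, finitely_generated (submodule I) ->
       nonnil_ideal I -> flat (submodule I)) ->
  nonnil_dual_basis R.
Proof.
move=> Iflat I Ifg Inn; have [s sI sN] := Inn.
refine (@inj_dual_basis R I s sI sN _ Ifg _).
  move=> j; apply: (flat_principal_regular hR sN).
  apply: Iflat; first exact: principal_fg.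
  by exists s => //; apply: cyclic_self.
by move=> B A _; apply: Iflat => //; apply: sub_incl_inj.
Qed.

Lemma phi_flat_nonnil_dual_basis (R : comNzRingType) (hR : phi_ring R) :
    (forall I : submodClosed R^o, finitely_generated (submodule I) ->
       phi_flat (submodule I)) ->
  nonnil_dual_basis R.
Proof.
move=> Iflat I Ifg [s sI sN].
refine (@inj_dual_basis R I s sI sN _ Ifg _).
  by move=> j; apply: (phi_flat_principal_regular hR sN);
    apply/Iflat/principal_fg.
by move=> B A; apply/phi_flat_inj/Iflat.
Qed.

Theorem theorem2p13 (R : comNzRingType) (hR : phi_ring R) :
  [<-> (* 1 *) phi_Prufer hR /\ strong_phi_ring R;
       (* 2 *) forall M : lmodType R, divisible M -> nonnil_FP_injective M;
       (* 3 *) forall M : lmodType R, h_divisible M -> nonnil_FP_injective M;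
       (* 4 *) forall I : submodClosed R^o,
                 finitely_generated (submodule I) -> nonnil_ideal I ->
                 projective (submodule I);
       (* 5 *) forall I : submodClosed R^o,
                 nonnil_ideal I -> flat (submodule I);
       (* 5' *) forall I : submodClosed R^o,
                 finitely_generated (submodule I) -> nonnil_ideal I ->
                 flat (submodule I);
       (* 6 *) forall I : submodClosed R^o, phi_flat (submodule I);
       (* 6' *) forall I : submodClosed R^o,
                 finitely_generated (submodule I) -> phi_flat (submodule I);
       (* 7 *) forall (M : lmodType R) (S : submodClosed M),
                 phi_flat M -> phi_flat (submodule S);
       (* 8 *) forall M : lmodType R,
                 exists (F : lmodType R) (f : {linear M -> F}),
                   phi_flat_preenvelope f /\ surjective f;
       (* 9 *) forall M : lmodType R,
                 exists (F : lmodType R) (f : {linear M -> F}),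
                   phi_flat_envelope f /\ surjective f].

Proof.
tfae.
- by move=> /nonnil_dual_basisP; apply: divisible_nonnil_FP_injective.
- by move=> h M /h_divisible_divisible; apply: h.
- move=> /h_divisible_dual_basis nnd I Ifg Inn.
  exact/dual_basis_projective/nnd.
- move=> h; have nnd : nonnil_dual_basis R.
    by move=> I Ifg Inn; apply: projective_dual_basis => //; apply: h.
  by move=> I; apply: nonnil_ideal_flat.
- by move=> h I _; apply: h.
- move=> /(flat_nonnil_dual_basis hR) nnd I.
  exact/submodule_phi_flat/regular_module_phi_flat.
- by move=> h I _; apply: h.
- by move=> /(phi_flat_nonnil_dual_basis hR) nnd M S; apply: submodule_phi_flat.
- move=> h; apply: (phi_flat_preenvelope_surj hR).
  apply: (phi_flat_nonnil_dual_basis hR) => I _.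
  exact/h/regular_module_phi_flat.
- move=> h M; have [F [f [fpre fsurj]]] := h M.
  by exists F, f; split=> //; apply: surjective_preenvelope.
move=> h; apply/nonnil_dual_basisP/(phi_flat_nonnil_dual_basis hR) => I _.
apply/preenvelope_submodule_phi_flat/regular_module_phi_flat => M.
by have [F [f [[fpre _] fsurj]]] := h M; exists F, f.
Qed.
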